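(* Let $\mathcal{G}$ be the class of all groups $G$ such that $G$ has no subgroup isomorphic to $\mathbb{Q}$, no subgroup isomorphic to the group $\mathbb{Z}_p$ of $p$-adic integers for any prime $p$, no subgroup isomorphic to the Prüfer $p$-group $\mathbb{Z}(p^\infty)$ for any prime $p$, and every torsion subgroup of $G$ is artinian. Then $\mathcal{G}$ is closed under taking extensions and graph products of groups. That is: (a) if $\{1\}\to A\to B\to C\to\{1\}$ is a short exact sequence of groups with $A,C\in\mathcal{G}$, then $B\in\mathcal{G}$; (b) if $\Gamma=(V,E)$ is a finite simplicial graph and $\{G_u\mid u\in V\}$ is a collection of groups with $G_u\in\mathcal{G}$ for all $u\in V$, then the graph product $G_\Gamma$ belongs to $\mathcal{G}$.
   Context: A torsion group is a group all of whose elements have finite order. A group is artinian if every non-empty collection of its subgroups has a minimal element with respect to inclusion. The Prüfer $p$-group $\mathbb{Z}(p^\infty)$ is the direct limit of the groups $\mathbb{Z}/p^n\mathbb{Z}$ under the embeddings $\mathbb{Z}/p^n\mathbb{Z}\to\mathbb{Z}/p^{n+1}\mathbb{Z}$ induced by multiplication by $p$. The groups $\mathbb{Q}$ and $\mathbb{Z}_p$ are the additive groups, regarded as abstract groups. Given a finite simplicial graph $\Gamma=(V,E)$ and groups $G_u$ ($u\in V$), the graph product $G_\Gamma$ is the quotient of the free product $\ast_{u\in V}G_u$ by the normal closure of all commutators $[g,h]$ with $g\in G_v$, $h\in G_w$, $\{v,w\}\in E$. *)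

(* Defs.v *)
(* Groups are groupType's: possibly infinite, written multiplicatively.  The
   choiceType structure of a groupType is no restriction classically; quotients
   by undecidable relations rely on the axioms of mathcomp.classical.boolp. *)
From HB Require Import structures.
From mathcomp Require Import all_boot all_algebra.
From mathcomp Require Import boolp classical_sets functions.

Set Implicit Arguments.
Unset Strict Implicit.
Unset Printing Implicit Defensive.

Local Open Scope classical_set_scope.
Local Open Scope group_scope.
Local Open Scope quotient_scope.

Section Subgroups.
Context {G : groupType}.
Implicit Types (S H K L : set G) (x y : G).

Definition subgroup H : Prop := group_closed [in H].

Lemma subgroupP H :
  subgroup H <-> H 1 /\ (forall x y, H x -> H y -> H (x / y)).
Proof.
split=> [[H1 HF]|[H1 HF]]; split.
- by rewrite -in_setE; apply: H1.
- by move=> x y Hx Hy; rewrite -in_setE; apply: HF; apply/mem_set.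
- exact/mem_set.
- by move=> x y /set_mem Hx /set_mem Hy; apply/mem_set/HF.
Qed.

Definition normal_subgroup H : Prop :=
  subgroup H /\ forall x y, H x -> H (x ^ y).

Definition normal_closure S : set G :=
  \bigcap_(N in [set N | normal_subgroup N /\ S `<=` N]) N.

Definition torsion_subgroup H : Prop :=
  subgroup H /\ forall x, H x -> exists2 n : nat, (0 < n)%N & x ^+ n = 1.

(* The subgroups of the group H are the subgroups of G contained in H. *)
Definition artinian_subgroup H : Prop :=
  subgroup H /\
  forall F : set (set G),
    F !=set0 -> (forall K, F K -> subgroup K /\ K `<=` H) ->
    exists2 K, F K & forall L, F L -> L `<=` K -> L = K.

Lemma normal_closure_normal S : normal_subgroup (normal_closure S).
Proof.
split; first (apply/subgroupP; split).
- by move=> N NP; have [[/subgroupP[N1 _] _] _] := NP.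
- move=> x y Hx Hy N NP; have [[/subgroupP[_ NF] _] _] := NP.
  by apply: NF; [apply: Hx | apply: Hy].
- by move=> x y Hx N NP; have [[_ NJ] _] := NP; apply: NJ; apply: Hx.
Qed.

Lemma sub_normal_closure S : S `<=` normal_closure S.
Proof. by move=> x Sx N [_]; apply. Qed.

Lemma normal_closure_min S N :
  normal_subgroup N -> S `<=` N -> normal_closure S `<=` N.
Proof. by move=> nN SN x; apply. Qed.

End Subgroups.

Definition has_subgroup_isomorphic_to (G K : groupType) : Prop :=
  exists2 H : set G, subgroup H &
    exists f : {multiplicative K -> G}, set_bij [set: K] H f.

Definition short_exact (A B C : groupType)
    (f : {multiplicative A -> B}) (g : {multiplicative B -> C}) : Prop :=
  [/\ injective f, range f = [set b | g b = 1] & set_surj setT setT g].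

Section QuotientByRelators.
Context {G : groupType} (S : set G).
Local Notation N := (normal_closure S).

Definition relators_rel : rel G := fun x y => `[< N (x^-1 * y) >].

Let N1 : N 1. Proof. by have [/subgroupP[]] := normal_closure_normal S. Qed.
Let NV x : N x -> N x^-1.
Proof.
have [/subgroupP[_ NF] _] := normal_closure_normal S.
by move=> Nx; rewrite -div1g; apply: NF.
Qed.
Let NM x y : N x -> N y -> N (x * y).
Proof.
have [/subgroupP[_ NF] _] := normal_closure_normal S.
by move=> Nx Ny; rewrite -[y]invgK; apply: NF => //; apply: NV.
Qed.
Let NJ x y : N x -> N (x ^ y).
Proof. by have [_] := normal_closure_normal S; apply. Qed.

Lemma relators_rel_refl : reflexive relators_rel.
Proof. by move=> x; apply/asboolP; rewrite mulVg. Qed.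
Lemma relators_rel_sym : symmetric relators_rel.
Proof.
by move=> x y; apply/asboolP/asboolP => /NV; rewrite invgM invgK.
Qed.
Lemma relators_rel_trans : transitive relators_rel.
Proof.
move=> y x z /asboolP Nxy /asboolP Nyz; apply/asboolP.
by have := NM Nxy Nyz; rewrite -mulgA mulVKg.
Qed.

Canonical relators_equiv :=
  EquivRel relators_rel relators_rel_refl relators_rel_sym relators_rel_trans.

Definition relators_quotient := {eq_quot relators_equiv}.
HB.instance Definition _ := Choice.on relators_quotient.
HB.instance Definition _ := EqQuotient.on relators_quotient.
Local Notation Q := relators_quotient.

Definition quot_one : Q := \pi_Q 1.
Definition quot_inv (a : Q) : Q := \pi_Q (repr a)^-1.
Definition quot_mul (a b : Q) : Q := \pi_Q (repr a * repr b).

Lemma quot_piP x y : reflect (N (x^-1 * y)) (\pi_Q x == \pi_Q y).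
Proof. by rewrite eqmodE; apply: (iffP (asboolP _)). Qed.

Lemma quot_repr x : N (x^-1 * repr (\pi_Q x)).
Proof. by apply/quot_piP; rewrite reprK. Qed.

Lemma quot_piM x y : \pi_Q (x * y) = quot_mul (\pi_Q x) (\pi_Q y).
Proof.
apply/eqP/quot_piP.
set x' := repr (\pi_Q x); set y' := repr (\pi_Q y).
have -> : (x * y)^-1 * (x' * y') = (x^-1 * x') ^ y * (y^-1 * y').
  by rewrite invgM /conjg -!mulgA mulVKg.
by apply: NM; [apply: NJ|]; apply: quot_repr.
Qed.

Lemma quot_piV x : \pi_Q x^-1 = quot_inv (\pi_Q x).
Proof.
apply/eqP/quot_piP; set x' := repr (\pi_Q x).
have -> : x^-1^-1 * x'^-1 = ((x^-1 * x')^-1) ^ x^-1.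
  by rewrite invgM /conjg !invgK -!mulgA mulgV mulg1.
by apply: NJ; apply: NV; apply: quot_repr.
Qed.

Lemma quot_mulA : associative quot_mul.
Proof.
elim/quotW=> x; elim/quotW=> y; elim/quotW=> z.
by rewrite -(quot_piM y z) -(quot_piM x (y * z)) -(quot_piM x y)
  -(quot_piM (x * y) z) mulgA.
Qed.
Lemma quot_mul1 : left_id quot_one quot_mul.
Proof. by elim/quotW=> x; rewrite -(quot_piM 1 x) mul1g. Qed.
Lemma quot_1mul : right_id quot_one quot_mul.
Proof. by elim/quotW=> x; rewrite -(quot_piM x 1) mulg1. Qed.
Lemma quot_mulV : left_inverse quot_one quot_inv quot_mul.
Proof. by elim/quotW=> x; rewrite -(quot_piV x) -(quot_piM x^-1 x) mulVg. Qed.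
Lemma quot_Vmul : right_inverse quot_one quot_inv quot_mul.
Proof. by elim/quotW=> x; rewrite -(quot_piV x) -(quot_piM x x^-1) mulgV. Qed.

HB.instance Definition _ := isGroup.Build Q
  quot_mulA quot_mul1 quot_1mul quot_mulV quot_Vmul.

Definition quot_proj (x : G) : Q := \pi_Q x.
HB.instance Definition _ := isMultiplicative.Build G Q quot_proj quot_piM.

Lemma quot_projP x : quot_proj x = 1 <-> N x.
Proof.
split=> [/esym/eqP/quot_piP|Nx]; first by rewrite invg1 mul1g.
by apply/esym/eqP/quot_piP; rewrite invg1 mul1g.
Qed.

Lemma quot_proj_surj a : exists x, quot_proj x = a.
Proof. by exists (repr a); apply: reprK. Qed.

End QuotientByRelators.

Section FreeProduct.
Context {V : choiceType} (G : V -> groupType).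

Definition syllable := {u : V & G u}.
Definition syl u (g : G u) : syllable := existT (fun u => G u : Type) u g.

(* The congruence on words that identifies each product of two syllables of a
   common factor with a single syllable, and each trivial syllable with the
   empty word. *)
Inductive free_prod_eq : seq syllable -> seq syllable -> Prop :=
| FPrefl w : free_prod_eq w w
| FPsym w w' : free_prod_eq w w' -> free_prod_eq w' w
| FPtrans w1 w2 w3 :
    free_prod_eq w1 w2 -> free_prod_eq w2 w3 -> free_prod_eq w1 w3
| FPmul w w' u (g h : G u) :
    free_prod_eq (w ++ [:: syl g, syl h & w']) (w ++ syl (g * h) :: w')
| FPone w w' u : free_prod_eq (w ++ syl (1 : G u) :: w') (w ++ w').

Definition free_prod_rel : rel (seq syllable) :=
  fun w w' => `[< free_prod_eq w w' >].

Lemma free_prod_rel_refl : reflexive free_prod_rel.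
Proof. by move=> w; apply/asboolP/FPrefl. Qed.
Lemma free_prod_rel_sym : symmetric free_prod_rel.
Proof. by move=> w w'; apply/asboolP/asboolP; apply: FPsym. Qed.
Lemma free_prod_rel_trans : transitive free_prod_rel.
Proof.
by move=> w2 w1 w3 /asboolP h12 /asboolP h23; apply/asboolP/(FPtrans h12).
Qed.

Canonical free_prod_equiv := EquivRel free_prod_rel
  free_prod_rel_refl free_prod_rel_sym free_prod_rel_trans.

Definition free_product := {eq_quot free_prod_equiv}.
HB.instance Definition _ := Choice.on free_product.
HB.instance Definition _ := EqQuotient.on free_product.
Local Notation Q := free_product.

Lemma free_prod_eq_catl w w1 w2 :
  free_prod_eq w1 w2 -> free_prod_eq (w ++ w1) (w ++ w2).
Proof.
elim=> [w'|w' w'' _ IH|u1 u2 u3 _ IH1 _ IH2|u1 u2 u g h|u1 u2 u].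
- exact: FPrefl.
- exact: FPsym.
- exact: FPtrans IH1 IH2.
- by rewrite !catA; apply: FPmul.
- by rewrite !catA; apply: FPone.
Qed.

Lemma free_prod_eq_catr w w1 w2 :
  free_prod_eq w1 w2 -> free_prod_eq (w1 ++ w) (w2 ++ w).
Proof.
elim=> [w'|w' w'' _ IH|u1 u2 u3 _ IH1 _ IH2|u1 u2 u g h|u1 u2 u].
- exact: FPrefl.
- exact: FPsym.
- exact: FPtrans IH1 IH2.
- by rewrite -!catA; apply: FPmul.
- by rewrite -!catA; apply: FPone.
Qed.

Definition syl_inv (s : syllable) : syllable :=
  let: existT u g := s in syl g^-1.
Definition word_inv (w : seq syllable) : seq syllable :=
  rev [seq syl_inv s | s <- w].

Lemma word_inv_cat w1 w2 : word_inv (w1 ++ w2) = word_inv w2 ++ word_inv w1.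
Proof. by rewrite /word_inv map_cat rev_cat. Qed.
Lemma word_inv_cons s w : word_inv (s :: w) = word_inv w ++ [:: syl_inv s].
Proof. by rewrite -cat1s word_inv_cat. Qed.

Lemma free_prod_eq_inv w1 w2 :
  free_prod_eq w1 w2 -> free_prod_eq (word_inv w1) (word_inv w2).
Proof.
elim=> [w'|w' w'' _ IH|u1 u2 u3 _ IH1 _ IH2|u1 u2 u g h|u1 u2 u].
- exact: FPrefl.
- exact: FPsym.
- exact: FPtrans IH1 IH2.
- rewrite !word_inv_cat !word_inv_cons -!catA /= invgM.
  exact: FPmul.
- rewrite !word_inv_cat !word_inv_cons -!catA /= invg1.
  exact: FPone.
Qed.

Lemma free_prod_eq_mulV w : free_prod_eq (w ++ word_inv w) [::].
Proof.
elim: w => [|[u g] w IH]; first exact: FPrefl.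
rewrite word_inv_cons -[_ :: w]cat1s -catA (catA w).
apply: FPtrans (free_prod_eq_catl [:: _] (free_prod_eq_catr _ IH)) _ => /=.
apply: FPtrans (FPmul [::] [::] g g^-1) _ => /=.
by rewrite mulgV; apply: FPone [::] [::] u.
Qed.

Lemma word_invK : involutive word_inv.
Proof.
move=> w; rewrite /word_inv map_rev revK -map_comp -[RHS]map_id.
by apply: eq_map => -[u g] /=; rewrite invgK.
Qed.

Definition fp_one : Q := \pi_Q [::].
Definition fp_inv (a : Q) : Q := \pi_Q (word_inv (repr a)).
Definition fp_mul (a b : Q) : Q := \pi_Q (repr a ++ repr b).

Lemma fp_piP w w' : reflect (free_prod_eq w w') (\pi_Q w == \pi_Q w').
Proof. by rewrite eqmodE; apply: (iffP (asboolP _)). Qed.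

Lemma fp_repr w : free_prod_eq w (repr (\pi_Q w)).
Proof. by apply/fp_piP; rewrite reprK. Qed.

Lemma fp_piM w w' : \pi_Q (w ++ w') = fp_mul (\pi_Q w) (\pi_Q w').
Proof.
apply/eqP/fp_piP; apply: FPtrans (free_prod_eq_catl _ (fp_repr w')) _.
exact/free_prod_eq_catr/fp_repr.
Qed.

Lemma fp_piV w : \pi_Q (word_inv w) = fp_inv (\pi_Q w).
Proof. exact/eqP/fp_piP/free_prod_eq_inv/fp_repr. Qed.

Lemma fp_mulA : associative fp_mul.
Proof.
elim/quotW=> x; elim/quotW=> y; elim/quotW=> z.
by rewrite -(fp_piM y z) -(fp_piM x (y ++ z)) -(fp_piM x y)
  -(fp_piM (x ++ y) z) catA.
Qed.
Lemma fp_mul1 : left_id fp_one fp_mul.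
Proof. by elim/quotW=> x; rewrite -(fp_piM [::] x). Qed.
Lemma fp_1mul : right_id fp_one fp_mul.
Proof. by elim/quotW=> x; rewrite -(fp_piM x [::]) cats0. Qed.
Lemma fp_Vmul : right_inverse fp_one fp_inv fp_mul.
Proof.
elim/quotW=> x; rewrite -(fp_piV x) -(fp_piM x (word_inv x)).
exact/eqP/fp_piP/free_prod_eq_mulV.
Qed.
Lemma fp_mulV : left_inverse fp_one fp_inv fp_mul.
Proof.
elim/quotW=> x; rewrite -(fp_piV x) -(fp_piM (word_inv x) x).
by apply/eqP/fp_piP; rewrite -{2}[x]word_invK; apply: free_prod_eq_mulV.
Qed.

HB.instance Definition _ := isGroup.Build Q
  fp_mulA fp_mul1 fp_1mul fp_mulV fp_Vmul.

Definition fp_in u (g : G u) : Q := \pi_Q [:: syl g].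

Lemma fp_inM u : {morph @fp_in u : g h / g * h}.
Proof.
move=> g h; rewrite /fp_in -[RHS]fp_piM /=.
by apply/esym/eqP/fp_piP/(FPmul [::] [::]).
Qed.
HB.instance Definition _ u :=
  isMultiplicative.Build (G u) Q (@fp_in u) (@fp_inM u).

End FreeProduct.

Section GraphProduct.
Context {V : choiceType} (E : rel V) (G : V -> groupType).

(* E is the adjacency relation of the graph. *)
Definition graph_relators : set (free_product G) :=
  [set x | exists v w (g : G v) (h : G w),
             E v w /\ x = [~ fp_in g, fp_in h]].

Definition graph_product : groupType := relators_quotient graph_relators.

End GraphProduct.
Arguments graph_relators {V} E G _.

Section PrimePowerCyclic.
Variable p : nat.

(* The additive group Z/p^n, for p > 0: (p ^ n).-1.+1 is p ^ n, in the form
   that gives access to the zmodType structure of 'I_m.+1 (also for n = 0). *)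
Definition Zpow n : zmodType := 'I_(p ^ n).-1.+1.

Definition Zpow_red n (x : Zpow n.+1) : Zpow n := inZp (x : 'I_ _).

(* The embedding Z/p^n -> Z/p^(k+n) induced by multiplication by p^k, which is
   the k-fold iterate of the one induced by multiplication by p. *)
Definition Zpow_emb k n (x : Zpow n) : Zpow (k + n) :=
  inZp (p ^ k * (x : 'I_ _))%N.

Lemma Zpow_dvd n : ((p ^ n).-1.+1 %| (p ^ n.+1).-1.+1)%N.
Proof.
have [->|p_gt0] := posnP p; first by case: n => [|n]; rewrite ?dvd1n ?exp0n.
by rewrite !prednK ?expn_gt0 ?p_gt0 // dvdn_exp2l.
Qed.

Lemma Zpow_redD n : {morph @Zpow_red n : x y / (x + y)%R}.
Proof.
move=> x y; apply: val_inj => /=.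
by rewrite modn_dvdm ?Zpow_dvd // modnDml modnDmr.
Qed.

Lemma Zpow_red0 n : @Zpow_red n 0%R = 0%R.
Proof. by apply: val_inj; rewrite /= mod0n. Qed.

Lemma Zpow_redN n : {morph @Zpow_red n : x / (- x)%R}.
Proof.
move=> x; apply/eqP; rewrite -GRing.subr_eq0 GRing.opprK -Zpow_redD.
by rewrite GRing.addNr Zpow_red0.
Qed.

(* Inverse limit of the groups Z/p^n under reduction. *)
Record padic := Padic {
  padic_seq :> forall n, Zpow n;
  padic_coherent : forall n, Zpow_red (padic_seq n.+1) = padic_seq n
}.

Lemma padic_ext (x y : padic) : (forall n, x n = y n) -> x = y.
Proof.
case: x y => [x cx] [y cy] /= eq_xy.
have {eq_xy} exy : x = y by apply: functional_extensionality_dep.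
by case: _ / exy in cy *; congr Padic; apply: Prop_irrelevance.
Qed.

HB.instance Definition _ := gen_eqMixin padic.
HB.instance Definition _ := gen_choiceMixin padic.

Definition padic_zero := @Padic (fun=> 0%R) Zpow_red0.

Lemma padic_opp_coherent (x : padic) n :
  Zpow_red (- x n.+1)%R = (- x n)%R.
Proof. by rewrite Zpow_redN padic_coherent. Qed.
Definition padic_opp x := Padic (padic_opp_coherent x).

Lemma padic_add_coherent (x y : padic) n :
  Zpow_red (x n.+1 + y n.+1)%R = (x n + y n)%R.
Proof. by rewrite Zpow_redD !padic_coherent. Qed.
Definition padic_add x y := Padic (padic_add_coherent x y).

Lemma padic_addA : associative padic_add.
Proof. by move=> x y z; apply: padic_ext => n /=; rewrite GRing.addrA. Qed.
Lemma padic_addC : commutative padic_add.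
Proof. by move=> x y; apply: padic_ext => n /=; rewrite GRing.addrC. Qed.
Lemma padic_add0 : left_id padic_zero padic_add.
Proof. by move=> x; apply: padic_ext => n /=; rewrite GRing.add0r. Qed.
Lemma padic_addN : left_inverse padic_zero padic_opp padic_add.
Proof. by move=> x; apply: padic_ext => n /=; rewrite GRing.addNr. Qed.

HB.instance Definition _ := GRing.isZmodule.Build padic
  padic_addA padic_addC padic_add0 padic_addN.

End PrimePowerCyclic.

Section Prufer.
Variables (p : nat) (p_pr : prime p).

Let pX_gt0 n : (0 < p ^ n)%N. Proof. by rewrite expn_gt0 prime_gt0. Qed.

Lemma Zpow_card n : (p ^ n).-1.+1 = (p ^ n)%N.
Proof. by rewrite prednK. Qed.

(* Disjoint union of the groups Z/p^n. *)
Definition prufer_pre := {n : nat & Zpow p n}.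
Definition pre_class n (a : nat) : prufer_pre :=
  existT (fun n => Zpow p n : Type) n (inZp a).
Definition pre_val (s : prufer_pre) : nat := (tagged s : 'I_ _).

Lemma Zpow_embE k n (x : Zpow p n) :
  Zpow_emb k x = (p ^ k * (x : 'I_ _))%N :> nat.
Proof.
rewrite /= (Zpow_card (k + n)) modn_small // expnD ltn_pmul2l //.
by rewrite -[X in (_ < X)%N](Zpow_card n) ltn_ord.
Qed.

Lemma pre_valE n a : pre_val (pre_class n a) = (a %% p ^ n)%N.
Proof. by rewrite /pre_val /= Zpow_card. Qed.

Lemma pre_val_lt s : (pre_val s < p ^ tag s)%N.
Proof. by rewrite -[X in (_ < X)%N]Zpow_card ltn_ord. Qed.

(* Since the transition maps are injective, x in Z/p^m and y in Z/p^n have the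
   same image in the direct limit iff they have the same image in Z/p^(m+n). *)
Definition prufer_rel : rel prufer_pre := fun s t =>
  Zpow_emb (tag t) (tagged s) == Zpow_emb (tag s) (tagged t) :> nat.

Lemma prufer_relE s t :
  prufer_rel s t = (p ^ tag t * pre_val s == p ^ tag s * pre_val t)%N.
Proof. by rewrite /prufer_rel !Zpow_embE. Qed.

Lemma prufer_rel_refl : reflexive prufer_rel.
Proof. by move=> s; rewrite prufer_relE. Qed.
Lemma prufer_rel_sym : symmetric prufer_rel.
Proof. by move=> s t; rewrite !prufer_relE eq_sym. Qed.
Lemma prufer_rel_trans : transitive prufer_rel.
Proof.
move=> t s u; rewrite !prufer_relE => /eqP st /eqP tu.
rewrite -(eqn_pmul2l (pX_gt0 (tag t))) mulnCA st mulnCA tu.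
by rewrite mulnCA.
Qed.

Canonical prufer_equiv :=
  EquivRel prufer_rel prufer_rel_refl prufer_rel_sym prufer_rel_trans.

Definition prufer := {eq_quot prufer_equiv}.
HB.instance Definition _ := Choice.on prufer.
HB.instance Definition _ := EqQuotient.on prufer.

Lemma prufer_piP s t : reflect (p ^ tag t * pre_val s = p ^ tag s * pre_val t)%N
  (\pi_prufer s == \pi_prufer t).
Proof. by rewrite eqmodE /= prufer_relE; apply: eqP. Qed.

Definition pre_opp (s : prufer_pre) : prufer_pre :=
  Tagged (Zpow p) (- tagged s)%R.
(* Addition in Z/p^(m+n), after embedding both arguments there. *)
Definition pre_add (s t : prufer_pre) : prufer_pre :=
  pre_class (tag s + tag t)
    (Zpow_emb (tag t) (tagged s) + Zpow_emb (tag s) (tagged t)).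

Definition prufer_zero : prufer :=
  \pi_prufer (Tagged (Zpow p) (0%R : Zpow p 0)).
Definition prufer_opp (x : prufer) : prufer := \pi_prufer (pre_opp (repr x)).
Definition prufer_add (x y : prufer) : prufer :=
  \pi_prufer (pre_add (repr x) (repr y)).

Lemma pre_addE s t : pre_val (pre_add s t) =
  ((p ^ tag t * pre_val s + p ^ tag s * pre_val t) %% p ^ (tag s + tag t))%N.
Proof.
by rewrite /pre_add pre_valE !Zpow_embE.
Qed.

Lemma pre_addC s t : pre_add s t = pre_add t s.
Proof. by congr pre_class; apply: addnC. Qed.

Lemma pre_add_compat s s' t : prufer_rel s s' ->
  prufer_rel (pre_add s t) (pre_add s' t).
Proof.
rewrite !prufer_relE !pre_addE /= => /eqP ss'.
rewrite !muln_modr -!expnD; apply/eqP.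
rewrite (addnC (tag s + tag t)%N); congr (_ %% _)%N.
rewrite !mulnDr !mulnA -!expnD; congr (_ + _)%N.
  rewrite !expnD; move: ss'.
  move: (p ^ tag s)%N (p ^ tag s')%N (p ^ tag t)%N => x x' y ss'.
  by rewrite !(mulnAC _ y (pre_val _)) ss'.
by congr (expn p _ * _)%N; rewrite [LHS]addnC -[RHS]addnA (addnC (tag t)).
Qed.

Lemma prufer_piD s t :
  \pi_prufer (pre_add s t) = prufer_add (\pi_prufer s) (\pi_prufer t).
Proof.
have rE u : prufer_rel u (repr (\pi_prufer u)).
  by rewrite -[prufer_rel]/(equiv prufer_equiv) -eqmodE reprK.
apply/eqP; rewrite eqmodE /=.
apply: (@prufer_rel_trans (pre_add (repr (\pi_prufer s)) t)).
  exact: pre_add_compat.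
by rewrite ![pre_add (repr (\pi_prufer s)) _]pre_addC; apply: pre_add_compat.
Qed.

Lemma prufer_addA : associative prufer_add.
Proof.
elim/quotW=> s; elim/quotW=> t; elim/quotW=> u.
rewrite -(prufer_piD t u) -(prufer_piD s) -(prufer_piD s t) -(prufer_piD _ u).
apply/eqP/prufer_piP; rewrite !pre_addE /= -addnA; congr (_ * _)%N.
rewrite !muln_modr -!expnD modnDmr (addnC (tag u)) -addnA modnDml.
congr (_ %% _)%N; rewrite !mulnDr !mulnA -!expnD addnA.
by rewrite (addnC (tag u)) (addnC (tag u)).
Qed.
Lemma prufer_addC : commutative prufer_add.
Proof.
elim/quotW=> s; elim/quotW=> t.
by rewrite -(prufer_piD s t) pre_addC prufer_piD.
Qed.
Lemma pre_val0 : pre_val (Tagged (Zpow p) (0%R : Zpow p 0)) = 0%N.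
Proof. by []. Qed.
Lemma prufer_add0 : left_id prufer_zero prufer_add.
Proof.
elim/quotW=> s; rewrite -(prufer_piD _ s); apply/eqP/prufer_piP.
rewrite pre_addE pre_val0 [tag (pre_add _ _)]/= [tag (Tagged _ _)]/=.
rewrite !add0n expn0 mul1n muln0 add0n.
by rewrite modn_small ?pre_val_lt.
Qed.
Lemma prufer_addN : left_inverse prufer_zero prufer_opp prufer_add.
Proof.
move=> x; rewrite -{2}[x]reprK -(prufer_piD (pre_opp (repr x)) (repr x)).
move: (repr x) => {x}s; apply/eqP/prufer_piP.
rewrite pre_addE pre_val0 muln0 mul1n.
rewrite [tag (pre_opp s)]/= -mulnDr expnD -muln_modr.
have -> : ((pre_val (pre_opp s) + pre_val s) %% p ^ tag s = 0)%N.
  rewrite -[X in (_ %% X)%N]Zpow_card.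
  exact: (congr1 (@nat_of_ord _) (GRing.addNr (tagged s))).
by rewrite muln0.
Qed.

HB.instance Definition _ := GRing.isZmodule.Build prufer
  prufer_addA prufer_addC prufer_add0 prufer_addN.

(* The canonical maps to the direct limit: the lemmas below say that they are
   compatible injective morphisms that are jointly surjective. *)
Definition prufer_in n (x : Zpow p n) : prufer :=
  \pi_prufer (Tagged (Zpow p) x).

Lemma prufer_in_emb k n (x : Zpow p n) : prufer_in (Zpow_emb k x) = prufer_in x.
Proof.
apply/eqP/prufer_piP; rewrite /pre_val Zpow_embE /=.
by rewrite mulnA -expnD addnC.
Qed.

Lemma prufer_in_inj n : injective (@prufer_in n).
Proof.
move=> x y /eqP/prufer_piP /= /eqP; rewrite eqn_pmul2l // => /eqP.
exact: val_inj.
Qed.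

Lemma prufer_in_cover a : exists n (x : Zpow p n), prufer_in x = a.
Proof. by elim/quotW: a => -[n x]; exists n, x. Qed.

Lemma prufer_inD n : {morph @prufer_in n : x y / (x + y)%R}.
Proof.
move=> x y; rewrite /prufer_in -[RHS]prufer_piD.
apply/eqP/prufer_piP; rewrite pre_addE /=.
rewrite -mulnDr expnD -muln_modr -mulnA; congr (_ * (_ * _))%N.
by rewrite -[X in (_ %% X)%N]Zpow_card.
Qed.

End Prufer.

(* to_multiplicative turns an additive group into a groupType: its product is
   the addition. *)
Definition class_G (G : groupType) : Prop :=
  [/\ ~ has_subgroup_isomorphic_to G (Algebra.to_multiplicative rat),
      forall p : nat, prime p ->
        ~ has_subgroup_isomorphic_to G (Algebra.to_multiplicative (padic p)),
      forall (p : nat) (p_pr : prime p),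
        ~ has_subgroup_isomorphic_to G (Algebra.to_multiplicative (prufer p_pr)) &
      forall H : set G, torsion_subgroup H -> artinian_subgroup H].

(* Main.v *)
Require Import Defs.
From HB Require Import structures.
From mathcomp Require Import all_boot all_algebra.
From mathcomp Require Import boolp classical_sets functions.
From mathcomp Require Import ring.

Set Implicit Arguments.
Unset Strict Implicit.
Unset Printing Implicit Defensive.

Import GRing.Theory Num.Theory.

(** Call a set of elements of a group small when it contains no nontrivial
    divisible abelian subgroup and no copy of the p-adic integers, and its
    torsion subgroups are artinian.  A nontrivial divisible abelian group
    contains a Pruefer group if it has torsion and a copy of the rationals
    otherwise, so a group belongs to the class if and only if the whole group
    is small ([class_G_small]).

    Extensions ([small_extension]).  Divisible subgroups and the artinian
    condition pass through a morphism directly.  If the p-adic integers embed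
    in the middle group and the composite to the quotient kills some x <> 0,
    then the image of p^k Z_p in the quotient is divisible, where k is the
    valuation of x; being contained in a small set it is trivial, so that the
    kernel contains p^k Z_p, which is again a copy of the p-adic integers.

    Graph products ([small_generated]).  Adding one vertex v to a set S of
    vertices, the subgroup generated by the factors of v :: S is mapped by the
    retractions onto the subgroup generated by S and onto the factor G v.  Both
    are small, so by the extension argument it remains to deal with the common
    kernel N of the two retractions ([small_add_vertex]).  The group N is free,
    being the fundamental group of a graph, and a Magnus representation makes
    it accessible to algebra.  Let Q be the product of the graph product with G v, and
    let M be the group of functions from words over the alphabet Q to the
    integers, that is, of noncommutative power series.  Let Q act on M by left
    translation of the letters, and let e be left multiplication by 1 + a,
    where a is the sum of the letters (h, 1) with h in the subgroup L generated
    by the neighbours of v in S.  Sending the factors in S to translations, and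
    the factor of v to translations conjugated by e, respects the relations of
    the graph product because L commutes with e.  Then
    - N acts by unipotent operators, T = 1 + (terms of positive degree), and
      comparing leading terms in T = Y^n, that is in T - 1 = n (Y - 1) + ...,
      shows that a group of such operators is torsion-free and that no
      nontrivial element has roots of all orders q^j ([unipotent_torsion_free],
      [unipotent_no_roots]);
    - N acts faithfully: an element outside the subgroup generated by S is a
      product h_0 g_1 h_1 ... g_n h_n with n > 0, g_i <> 1 in G v and h_i
      outside L for 0 < i < n, and following one coefficient through this
      product shows that it does not fix the power series 1 ([Psi_kernel]).
    Hence N is small ([root_free_small]), because divisible groups and the
    p-adic integers have elements with roots of all orders q^j. *)

(** * p-adic integers *)

Section PadicDigits.
Variables (p : nat) (p_pr : prime p).
Implicit Types (x y : padic p).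

Let pX_gt0 n : (0 < p ^ n)%N. Proof. by rewrite expn_gt0 prime_gt0. Qed.

Definition residue x n : nat := (x n : 'I_ _).

Lemma residueD x y n :
  residue (x + y)%R n = ((residue x n + residue y n) %% p ^ n)%N.
Proof. by rewrite /residue /= [X in modn _ X = _](Zpow_card p_pr). Qed.

Lemma residue0 n : residue 0%R n = 0%N.
Proof. by []. Qed.

Lemma residue_lt x n : (residue x n < p ^ n)%N.
Proof. by rewrite -[X in (_ < X)%N](Zpow_card p_pr) ltn_ord. Qed.

Lemma residue_red x n : (residue x n.+1 %% p ^ n)%N = residue x n.
Proof.
rewrite /residue -[in RHS](padic_coherent x n) /=.
by rewrite [X in _ = modn _ X](Zpow_card p_pr).
Qed.

Lemma residue_inj x y : (forall n, residue x n = residue y n) -> x = y.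
Proof. by move=> exy; apply: padic_ext => n; apply: val_inj; apply: exy. Qed.

Lemma residueMn x m n : residue (x *+ m)%R n = ((m * residue x n) %% p ^ n)%N.
Proof.
elim: m => [|m IH]; first by rewrite mulr0n residue0 mod0n.
by rewrite mulrS residueD IH modnDmr mulSn.
Qed.

Lemma padic_of_residues (a : nat -> nat) :
  (forall n, a n.+1 = a n %[mod p ^ n]) ->
  exists x, forall n, residue x n = (a n %% p ^ n)%N.
Proof.
move=> ca; pose b n : Zpow p n := inZp (a n).
have cb n : Zpow_red (b n.+1) = b n.
  apply: val_inj; rewrite /= !prednK // modn_dvdm ?dvdn_exp2l //.
by exists (Padic cb) => n; rewrite /residue /= prednK.
Qed.

Lemma padic_divp x : residue x 1 = 0%N -> exists y, (y *+ p)%R = x.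
Proof.
move=> x1; have dx n : (p %| residue x n.+1)%N.
  elim: n => [|n IH]; first by rewrite x1.
  rewrite /dvdn -(@modn_dvdm (p ^ n.+1)) ?dvdn_exp //.
  by rewrite residue_red.
have [|y yE] := @padic_of_residues (fun n => (residue x n.+1 %/ p)%N).
  by move=> n; rewrite -(residue_red x n.+1) expnSr -modn_divl modn_mod.
exists y; apply: residue_inj => n; rewrite residueMn yE modnMmr.
by rewrite mulnC divnK // residue_red.
Qed.

(** Since q is invertible modulo each p^n, the quotients exist modulo each p^n;
    they are coherent because they are unique. *)
Lemma padic_div_coprime q x : coprime q p -> exists y, (y *+ q)%R = x.
Proof.
move=> qp; have cq n : {c | c * q = 1 %[mod p ^ n]}.
  case: (posnP q) => [q0|q0].
    move: qp; rewrite q0 /coprime gcd0n => /eqP p1.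
    by exists 0%N; rewrite p1 exp1n !modn1.
  have /eqP := @coprimeXr n _ _ qp.
  case: (egcdnP (p ^ n) q0) => a b E _ g1; exists a.
  by rewrite E g1 modnMDl.
pose c n := sval (cq n); have cE n : c n * q = 1 %[mod p ^ n] := svalP (cq n).
have cx n : (c n * residue x n) * q = residue x n %[mod p ^ n].
  by rewrite mulnAC -modnMml cE modnMml mul1n.
have cancel n u v : u * q = v * q %[mod p ^ n] -> u = v %[mod p ^ n].
  have uE w : w = (w * q) * c n %[mod p ^ n].
    by rewrite -mulnA (mulnC q) -modnMmr cE modnMmr muln1.
  by move=> uv; rewrite (uE u) (uE v) -modnMml uv modnMml.
have [|y yE] := @padic_of_residues (fun n => (c n * residue x n)%N).
  move=> n; apply: cancel; rewrite cx.
  rewrite -(@modn_dvdm (p ^ n.+1)) ?dvdn_exp2l // cx modn_dvdm ?dvdn_exp2l //.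
  by rewrite -(residue_red x n) modn_mod.
exists y; apply: residue_inj => n; rewrite residueMn yE modnMmr mulnC cx.
by rewrite modn_small ?residue_lt.
Qed.

Lemma padic_mulp_inj x : (x *+ p = 0)%R -> x = 0%R.
Proof.
move=> xp0; apply: residue_inj => n; have := congr1 (residue ^~ n.+1) xp0.
rewrite residueMn residue0 => /eqP.
rewrite -/(dvdn _ _) expnS dvdn_pmul2l ?prime_gt0 //.
by move/eqP; rewrite residue_red.
Qed.

Lemma padic_unit_part x : x <> 0%R ->
  exists k u, residue u 1 <> 0%N /\ x = (u *+ p ^ k)%R.
Proof.
move=> x0; have [n xn0] : exists n, residue x n <> 0%N.
  apply: contrapT => nx; apply: x0; apply: residue_inj => n.
  by apply: contrapT => xn0; apply: nx; exists n.
elim: n x {x0} xn0 => [x|n IH x xn0].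
  by have := residue_lt x 0; case: (residue x 0).
have [x1|x1] := eqVneq (residue x 1) 0%N; last first.
  by exists 0%N, x; split; [apply/eqP | rewrite expn0 mulr1n].
have [y yE] := padic_divp x1.
have [|k [u [u1 uE]]] := IH y.
  move=> yn0; apply: xn0; rewrite -yE residueMn.
  apply/eqP; rewrite -/(dvdn _ _) expnS dvdn_pmul2l ?prime_gt0 //.
  by rewrite /dvdn residue_red yn0.
by exists k.+1, u; split=> //; rewrite -yE uE -mulrnA expnS mulnC.
Qed.

(** The quotient of Z_p by the subgroup spanned by a unit u is divisible.  It
    suffices to divide by primes q: if q <> p then q is invertible in Z_p, and
    if q = p then some multiple of u has the same residue modulo p as y. *)
Lemma padic_cokernel_divisible u y n : residue u 1 <> 0%N -> (0 < n)%N ->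
  exists z m, y = (z *+ n + u *+ m)%R.
Proof.
move=> u1; elim/ltn_ind: n y => n IH y n_gt0.
have [n1|n1] := leqP n 1.
  exists y, 0%N; rewrite (_ : n = 1%N); last by case: n n_gt0 n1 {IH} => [|[]].
  by rewrite mulr1n mulr0n addr0.
have q_pr := pdiv_prime n1; set q := pdiv n in q_pr.
have [z1 [m1 y1]] : exists z m, y = (z *+ q + u *+ m)%R.
  have [qp|qp] := boolP (coprime q p).
    have [z zE] := padic_div_coprime y qp.
    by exists z, 0%N; rewrite mulr0n addr0 zE.
  have {qp}-> : q = p.
    by apply/eqP; move: qp; rewrite prime_coprime // negbK dvdn_prime2.
  have cu : coprime (residue u 1) p.
    rewrite coprime_sym prime_coprime //; apply/negP => /eqP.
    by rewrite modn_small -?{2}[p]expn1 ?residue_lt.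
  have u1_gt0 : (0 < residue u 1)%N by case: (residue u 1) u1.
  case: (egcdnP p u1_gt0) => a b E _; move/eqP: cu => g1.
  pose m := (a * residue y 1)%N.
  have [|z zE] := @padic_divp (y - u *+ m)%R.
    have : residue (y - u *+ m + u *+ m)%R 1 = residue y 1 by rewrite subrK.
    rewrite residueD residueMn modnDmr expn1 /m mulnAC E g1 mulnDl mul1n mulnAC.
    rewrite addnCA modnMDl.
    move: (residue_lt y 1) (residue_lt (y - u *+ (a * residue y 1))%R 1).
    move: (residue y 1) (residue (y - _)%R 1) => r t.
    rewrite !expn1 => rp tp /eqP.
    rewrite -{2}[r](modn_small rp) -[X in _ == modn X _]add0n eqn_modDr mod0n.
    by rewrite modn_small // => /eqP.
  by exists z, m; rewrite zE subrK.
have nq_gt0 : (0 < n %/ q)%N.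
  by rewrite divn_gt0 ?pdiv_gt0 // dvdn_leq ?pdiv_dvd.
have [z2 [m2 z1E]] := IH (n %/ q)%N (ltn_Pdiv (prime_gt1 q_pr) n_gt0) z1 nq_gt0.
exists z2, (m2 * q + m1)%N; rewrite y1 z1E mulrnDl -!mulrnA.
by rewrite (divnK (pdiv_dvd n)) mulrnDr addrA.
Qed.
End PadicDigits.

(** * Subgroups and morphisms *)

Local Open Scope classical_set_scope.
Local Open Scope group_scope.
Local Open Scope quotient_scope.

Section GroupMorphisms.
Context {G H : groupType} (f : {multiplicative G -> H}).

Lemma hom1 : f 1 = 1.
Proof. by apply: (mulgI (f 1)); rewrite -gmulfM !mulg1. Qed.

Lemma homV x : f x^-1 = (f x)^-1.
Proof. by apply: (mulgI (f x)); rewrite -gmulfM !mulgV hom1. Qed.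

Lemma homF x y : f (x / y) = f x / f y.
Proof. by rewrite gmulfM homV. Qed.

Lemma homX x n : f (x ^+ n) = f x ^+ n.
Proof. by elim: n => [|n IH]; rewrite ?hom1 // !expgS gmulfM IH. Qed.

Lemma hom_inj : (forall x, f x = 1 -> x = 1) -> injective f.
Proof. by move=> fI x y xy; apply/divg1_eq/fI; rewrite homF xy divgg. Qed.

End GroupMorphisms.

Definition hom_of (G H : groupType) (f : G -> H)
    (fM : {morph f : x y / x * y}) : {multiplicative G -> H} :=
  HB.pack f (isMultiplicative.Build G H f fM).

Section SubgroupClosure.
Context {G : groupType}.
Implicit Types (H K : set G) (x y : G).

Lemma subgroup1 H : subgroup H -> H 1.
Proof. by case/subgroupP. Qed.

Lemma subgroupV H x : subgroup H -> H x -> H x^-1.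
Proof. by case/subgroupP=> H1 HF Hx; rewrite -div1g; apply: HF. Qed.

Lemma subgroupM H x y : subgroup H -> H x -> H y -> H (x * y).
Proof.
move=> sH Hx Hy; have [_ HF] := (subgroupP H).1 sH.
by rewrite -[y]invgK; apply: HF => //; apply: subgroupV.
Qed.

Lemma subgroupX H x n : subgroup H -> H x -> H (x ^+ n).
Proof.
move=> sH Hx; elim: n => [|n IH]; first exact: subgroup1.
by rewrite expgS; apply: subgroupM.
Qed.

Lemma subgroupI H K : subgroup H -> subgroup K -> subgroup (H `&` K).
Proof.
move=> /subgroupP[H1 HF] /subgroupP[K1 KF]; apply/subgroupP; split=> //.
by move=> x y [Hx Kx] [Hy Ky]; split; [apply: HF | apply: KF].
Qed.

Lemma subgroup_trivial : subgroup [set 1 : G].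
Proof. by apply/subgroupP; split=> // x y -> ->; rewrite divgg. Qed.

End SubgroupClosure.

Section Morphisms.
Context {G C : groupType} (f : {multiplicative G -> C}).

Definition kernel : set G := [set x | f x = 1].

Lemma kernel_subgroup : subgroup kernel.
Proof.
apply/subgroupP; split; first exact: hom1.
by move=> x y fx fy; rewrite /kernel /= homF fx fy divgg.
Qed.

Lemma image_subgroup H : subgroup H -> subgroup (f @` H).
Proof.
move=> sH; have [H1 HF] := (subgroupP H).1 sH; apply/subgroupP; split.
  by exists 1 => //; apply: hom1.
move=> _ _ [x Hx <-] [y Hy <-]; exists (x / y); first exact: HF.
exact: homF.
Qed.

End Morphisms.

Lemma hom_mulrn (A : zmodType) (G : groupType)
    (f : {multiplicative Algebra.to_multiplicative A -> G}) (x : A) n :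
  f (x *+ n)%R = f x ^+ n.
Proof. exact: homX. Qed.

Lemma hom_addr (A : zmodType) (G : groupType)
    (f : {multiplicative Algebra.to_multiplicative A -> G}) (x y : A) :
  f (x + y)%R = f x * f y.
Proof. exact: gmulfM. Qed.

Lemma hom_zero (A : zmodType) (G : groupType)
    (f : {multiplicative Algebra.to_multiplicative A -> G}) :
  f (0 : A)%R = 1.
Proof. exact: hom1. Qed.

(** * Small subsets of a group *)

Section Small.
Context {G : groupType}.
Implicit Types (H D T N : set G).

Definition divisible_subgroup D : Prop :=
  [/\ subgroup D,
      forall x y, D x -> D y -> commute x y &
      forall n x, (0 < n)%N -> D x -> exists2 y, D y & y ^+ n = x].

(** Being relative to an ambient group, this notion spares turning subgroups
    into groups of their own. *)
Definition small H : Prop :=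
  [/\ forall D, divisible_subgroup D -> D `<=` H -> D `<=` [set 1],
      forall p (f : {multiplicative Algebra.to_multiplicative (padic p) -> G}),
        prime p -> range f `<=` H -> ~ injective f &
      forall T, torsion_subgroup T -> T `<=` H -> artinian_subgroup T].

Lemma small_sub H K : K `<=` H -> small H -> small K.
Proof.
move=> KH [Hd Hp Ha]; split.
- by move=> D dD DK; apply: Hd => //; apply: subset_trans KH.
- by move=> p f pp fK; apply: Hp => //; apply: subset_trans KH.
- by move=> T tT TK; apply: Ha => //; apply: subset_trans KH.
Qed.

Lemma artinian_trivial : artinian_subgroup [set 1 : G].
Proof.
split=> [|F [K FK] Fsub]; first exact: subgroup_trivial.
have triv L : F L -> L = [set 1].
  move=> FL; have [sL L1] := Fsub L FL.
  by apply/seteqP; split=> // _ ->; apply: subgroup1.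
by exists K => // L FL _; rewrite (triv L) // (triv K).
Qed.

(** Divisible groups have roots of all orders, and the p-adic integers have
    roots of all orders prime to p. *)
Lemma root_free_small N :
    (forall n x, N x -> (0 < n)%N -> x ^+ n = 1 -> x = 1) ->
    (forall q x, prime q -> N x ->
       (forall j, exists2 y, N y & y ^+ (q ^ j) = x) -> x = 1) ->
  small N.
Proof.
move=> tfN dN; split.
- move=> D [sD _ divD] DN x Dx; apply: (dN 2) => //; first exact: DN.
  move=> j; have [|y Dy yE] := divD (2 ^ j)%N x _ Dx; first by rewrite expn_gt0.
  by exists y => //; apply: DN.
- move=> p f p_pr fN inj_f.
  have [q q_pr qp] : exists2 q, prime q & coprime q p.
    have [->|p2] := eqVneq p 2; first by exists 3.
    by exists 2 => //; rewrite prime_coprime // dvdn_prime2 // eq_sym.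
  have f1 (x : padic p) : f x = 1.
    apply: (dN q) => // [|j]; first by apply: fN; exists x.
    have [y yE] := @padic_div_coprime p p_pr (q ^ j) x (coprimeXl _ qp).
    exists (f y); first by apply: fN; exists y.
    by rewrite -hom_mulrn yE.
  have [x x1] : exists x : padic p, residue x 1 <> 0%N.
    have [|x xE] := @padic_of_residues p p_pr (fun=> 1%N); first by [].
    by exists x; rewrite xE expn1 modn_small ?prime_gt1.
  apply: x1; have -> // : x = 0%R.
  by apply: inj_f; rewrite f1 hom_zero.
- move=> T [sT torT] TN; have -> : T = [set 1]; last exact: artinian_trivial.
  apply/seteqP; split=> [x Tx|_ ->]; last exact: subgroup1.
  by have [n n_gt0 xn] := torT x Tx; apply: (tfN n) => //; apply: TN.
Qed.

End Small.

Section Extension.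
Context {G C : groupType} (f : {multiplicative G -> C}).
Implicit Types (H T : set G).

Lemma divisible_image D : divisible_subgroup D -> divisible_subgroup (f @` D).
Proof.
move=> [sD cD dD]; split; first exact: image_subgroup.
  by move=> _ _ [x Dx <-] [y Dy <-]; apply: gmulf_commute; apply: cD.
move=> n _ n0 [x Dx <-]; have [y Dy yx] := dD n x n0 Dx.
by exists (f y); [exists y | rewrite -homX yx].
Qed.

(** Choose first a member of the family whose intersection with the kernel is
    minimal, then, among those with this intersection, one whose image is
    minimal: a subgroup contained in it with the same intersection and the same
    image is equal to it. *)
Lemma artinian_extension T :
  subgroup T -> artinian_subgroup (f @` T) ->
  artinian_subgroup (T `&` kernel f) -> artinian_subgroup T.
Proof.
move=> sT [_ aQ] [_ aK]; split=> // F [K0 FK0] Fsub.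
have [_ [K1 FK1 <-] K1min] :
    exists2 M, [set K `&` kernel f | K in F] M &
      forall L, [set K `&` kernel f | K in F] L -> L `<=` M -> L = M.
  apply: aK; first by exists (K0 `&` kernel f); exists K0.
  move=> _ [K FK <-]; have [sK KT] := Fsub K FK; split.
    by apply: subgroupI => //; apply: kernel_subgroup.
  exact: setSI.
pose F1 := [set K | F K /\ K `&` kernel f = K1 `&` kernel f].
have [_ [K2 [FK2 K2E] <-] K2min] :
    exists2 M, [set f @` K | K in F1] M &
      forall L, [set f @` K | K in F1] L -> L `<=` M -> L = M.
  apply: aQ; first by exists (f @` K1); exists K1.
  move=> _ [K [FK _] <-]; have [sK KT] := Fsub K FK; split.
    exact: image_subgroup.
  exact: image_subset.
exists K2 => // L FL LK2; have [sL _] := Fsub L FL; have [sK2 _] := Fsub K2 FK2.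
have LkE : L `&` kernel f = K1 `&` kernel f.
  by apply: K1min; [exists L | rewrite -K2E; apply: setSI].
have fLE : f @` L = f @` K2.
  by apply: K2min; [exists L | apply: image_subset].
apply/seteqP; split=> // x K2x.
have [y Ly fyx] : (f @` L) (f x) by rewrite fLE; exists x.
have : (K2 `&` kernel f) (y^-1 * x).
  split; first by apply: subgroupM => //; apply: subgroupV => //; apply: LK2.
  by rewrite /kernel /= gmulfM homV fyx mulVg.
rewrite K2E -LkE => -[Lyx _].
by rewrite -(mulVKg y x); apply: subgroupM.
Qed.

(** For the p-adic integers: if g is an embedding of them whose composite with f
    kills x = u p^k, with u a unit, then f (g (p^k Z_p)) is divisible by
    [padic_cokernel_divisible], hence trivial, and y |-> g (p^k y) embeds the
    p-adic integers in the kernel. *)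
Lemma small_extension H :
  small (f @` H) -> small (H `&` kernel f) -> small H.
Proof.
move=> [Qd Qp Qa] [Kd Kp Ka]; split.
- move=> D dD DH; apply: (Kd D) => // x Dx; split; first exact: DH.
  apply: (Qd (f @` D) (divisible_image dD)); last by exists x.
  exact: image_subset.
- move=> p g p_pr gH inj_g.
  pose fg : {multiplicative Algebra.to_multiplicative (padic p) -> C} := f \o g.
  have : ~ injective fg.
    apply: Qp => // _ [x _ <-]; exists (g x) => //; apply: gH.
    by exists x.
  apply; apply: hom_inj => x; apply: contraPP => x0 fgx.
  have [k [u [u1 xE]]] := padic_unit_part p_pr x0.
  pose D := [set fg (y *+ p ^ k)%R | y in [set: padic p]].
  have dD : divisible_subgroup D.
    split.
    - apply/subgroupP; split.
        by exists 0%R => //; rewrite mul0rn hom_zero.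
      move=> _ _ [y _ <-] [z _ <-]; exists (y - z)%R => //.
      rewrite mulrnBl; exact: homF.
    - move=> _ _ [y _ <-] [z _ <-]; apply: gmulf_commute.
      exact: addrC.
    - move=> n _ n_gt0 [y _ <-].
      have [z [m yE]] := padic_cokernel_divisible p_pr y u1 n_gt0.
      exists (fg (z *+ p ^ k)%R); first by exists z.
      rewrite yE mulrnDl -!mulrnA hom_addr [in RHS]mulnC [(m * _)%N]mulnC.
      rewrite ![(u *+ _)%R]mulrnA -xE [fg (x *+ m)%R]hom_mulrn fgx expg1n.
      by rewrite mulg1 -hom_mulrn -mulrnA.
  have DH : D `<=` f @` H.
    move=> _ [y _ <-]; exists (g (y *+ p ^ k)%R) => //.
    by apply: gH; exists (y *+ p ^ k)%R.
  have D1 := Qd D dD DH.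
  pose h (y : Algebra.to_multiplicative (padic p)) :=
    g ((y : padic p) *+ p ^ k)%R.
  have hM : {morph h : a b / a * b}.
    by move=> a b; rewrite /h mulrnDl; apply: gmulfM.
  apply: (Kp p (hom_of hM)) => //.
    move=> _ [y _ <-]; split.
      by apply: gH; exists ((y : padic p) *+ p ^ k)%R.
    by apply: D1; exists y.
  move=> a b /inj_g; rewrite /=; elim: (k) => [|j IH] //.
  rewrite expnSr !mulrnA => ab; apply: IH.
  apply/eqP; rewrite -subr_eq0; apply/eqP.
  by apply: (padic_mulp_inj p_pr); rewrite mulrnBl ab subrr.
- move=> T tT TH; have [sT torT] := tT; apply: artinian_extension => //.
    apply: Qa; last exact: image_subset.
    split; first exact: image_subgroup.
    move=> _ [x Tx <-]; have [n n0 xn] := torT x Tx; exists n => //.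
    by rewrite -homX xn hom1.
  apply: Ka; last exact: setSI.
  split; first by apply: subgroupI => //; apply: kernel_subgroup.
  by move=> x [Tx _]; apply: torT.
Qed.

End Extension.

(** * The class in terms of small sets *)

Lemma has_subgroup_isomorphic_toP (G K : groupType) :
  has_subgroup_isomorphic_to G K <->
  exists f : {multiplicative K -> G}, injective f.
Proof.
split=> [[H sH [f [_ inj_f _]]]|[f inj_f]].
  by exists f => x y; apply: inj_f; rewrite inE.
exists (range f); first by apply: image_subgroup; apply/subgroupP.
exists f; split=> [x _|x y _ _|//]; [by exists x | exact: inj_f].
Qed.

(** The elements z n, with z n a p-th root of z n.-1, generate a copy of
    the Pruefer group in which z n corresponds to the class of 1 in Z/p^n. *)
Section RootTower.
Context {G : groupType} (p : nat) (p_pr : prime p) (z : nat -> G).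
Hypotheses (z0 : z 0 = 1) (zS : forall n, z n.+1 ^+ p = z n) (z1 : z 1 <> 1).

Lemma tower_root m n : z (m + n) ^+ (p ^ m) = z n.
Proof.
by elim: m => [|m IH]; rewrite ?expg1 // expnS expgnA addSn zS.
Qed.

Lemma tower_order n a : z n ^+ a = 1 -> (p ^ n %| a)%N.
Proof.
elim: n a => [|n IH] a; first by rewrite dvd1n.
move=> za; have : z n ^+ a = 1 by rewrite -zS expgnAC za expg1n.
move/IH/dvdnP=> [b ab]; rewrite {a}ab in za *.
rewrite expnS dvdn_pmul2r ?expn_gt0 ?prime_gt0 //.
have z1b : z 1 ^+ b = 1 by rewrite -(tower_root n 1) addn1 -expgnA mulnC.
apply/negPn/negP; rewrite -prime_coprime // => pb.
have b0 : (0 < b)%N.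
  case: b pb {za z1b} => //; rewrite /coprime gcdn0 => /eqP p1.
  by have := p_pr; rewrite p1.
case: (egcdnP p b0) => u v E _; apply: z1.
have : z 1 ^+ (u * b) = 1 by rewrite mulnC expgnA z1b expg1n.
rewrite E gcdnC (eqP pb) addn1 expgSr mulnC expgnA zS z0 expg1n.
by rewrite mul1g.
Qed.

Lemma tower_mod n a : z n ^+ (a %% p ^ n) = z n ^+ a.
Proof.
have zn : z n ^+ (p ^ n) = 1 by rewrite -(z0) -(tower_root n 0) addn0.
by rewrite [in RHS](divn_eq a (p ^ n)) expgnDr mulnC expgnA zn expg1n mul1g.
Qed.

Lemma tower_eq n a b : z n ^+ a = z n ^+ b -> (a %% p ^ n = b %% p ^ n)%N.
Proof.
wlog ab : a b / (a <= b)%N.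
  by move=> W; case: (leqP a b) => [|/ltnW] ab E; [exact: W | apply/esym/W].
move=> E; apply/esym/eqP; rewrite eqn_mod_dvd //; apply: tower_order.
by rewrite expgnFr // -E divgg.
Qed.

Let f0 (s : prufer_pre p) : G := z (tag s) ^+ pre_val s.

Let f0_lift (s : prufer_pre p) m : f0 s = z (m + tag s) ^+ (p ^ m * pre_val s).
Proof. by rewrite expgnA tower_root. Qed.

Let f0P (s t : prufer_pre p) :
  f0 s = f0 t <-> prufer_rel s t.
Proof.
rewrite (f0_lift s (tag t)) (f0_lift t (tag s)) [(tag s + _)%N]addnC.
rewrite (prufer_relE p_pr); split=> [/tower_eq E|/eqP -> //].
have small_lt (u v : prufer_pre p) :
    (p ^ tag v * pre_val u < p ^ (tag u + tag v))%N.
  by rewrite addnC expnD ltn_pmul2l ?expn_gt0 ?prime_gt0 ?pre_val_lt.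
apply/eqP; move: E.
by rewrite !modn_small // addnC.
Qed.

Definition tower_hom (a : prufer p_pr) : G := f0 (repr a).

Let tower_homE s : tower_hom (\pi_(prufer p_pr) s) = f0 s.
Proof.
apply/f0P; rewrite -[@prufer_rel p]/(equiv (prufer_equiv p_pr)) -eqmodE.
by rewrite reprK.
Qed.

Lemma tower_homD a b : tower_hom (a + b)%R = tower_hom a * tower_hom b.
Proof.
elim/quotW: a => s; elim/quotW: b => t.
transitivity (tower_hom (\pi_(prufer p_pr) (pre_add s t))).
  by congr tower_hom; apply: esym; apply: (prufer_piD p_pr s t).
rewrite !tower_homE {1}/f0 (pre_addE p_pr) tower_mod expgnDr.
by rewrite (f0_lift s (tag t)) (f0_lift t (tag s)) [(tag t + _)%N]addnC.
Qed.

Lemma tower_hom_inj : injective tower_hom.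
Proof.
elim/quotW=> s; elim/quotW=> t; rewrite !tower_homE => /f0P st.
by apply/eqP; rewrite eqmodE.
Qed.

Lemma tower_prufer :
  has_subgroup_isomorphic_to G (Algebra.to_multiplicative (prufer p_pr)).
Proof.
apply/has_subgroup_isomorphic_toP.
exists (@hom_of (Algebra.to_multiplicative _) _ tower_hom tower_homD).
exact: tower_hom_inj.
Qed.

End RootTower.

Section DivisibleTorsion.
Context {G : groupType} (D : set G) (divD : divisible_subgroup D).

Lemma prime_order_element n x : (0 < n)%N -> D x -> x <> 1 -> x ^+ n = 1 ->
  exists p y, [/\ prime p, D y, y <> 1 & y ^+ p = 1].
Proof.
have [sD _ _] := divD.
elim/ltn_ind: n => n IH n0 Dx x1 xn.
have n1 : (1 < n)%N.
  by case: n n0 xn {IH} => [|[|]] //; rewrite expg1 => _ /x1.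
have q_pr := pdiv_prime n1; set q := pdiv n in q_pr.
have nE : (n %/ q * q)%N = n by rewrite divnK ?pdiv_dvd.
have [xq|xq] := pselect (x ^+ (n %/ q) = 1).
  apply: (IH (n %/ q)%N) => //; first by rewrite ltn_Pdiv ?prime_gt1.
  by rewrite divn_gt0 ?pdiv_gt0 // dvdn_leq ?pdiv_dvd.
exists q, (x ^+ (n %/ q)); split=> //; first exact: subgroupX.
by rewrite -expgnA nE.
Qed.

Lemma divisible_torsion_prufer n x : (0 < n)%N -> D x -> x <> 1 -> x ^+ n = 1 ->
  exists p (p_pr : prime p),
    has_subgroup_isomorphic_to G (Algebra.to_multiplicative (prufer p_pr)).
Proof.
move=> n0 Dx x1 xn.
have [p [y [p_pr Dy y1 yp]]] := prime_order_element n0 Dx x1 xn.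
have [_ _ rootD] := divD.
have /choice [r rP] : forall y, exists y', D y -> D y' /\ y' ^+ p = y.
  move=> y'; have [Dy'|] := pselect (D y'); last by exists 1.
  by have [t Dt tE] := rootD p y' (prime_gt0 p_pr) Dy'; exists t.
pose z n := if n is m.+1 then iter m r y else 1.
have Dz m : D (z m.+1) by elim: m => [|m IH] //=; apply: (rP _ _).1.
exists p, p_pr; apply: (@tower_prufer _ _ p_pr z) => // -[|m] //=.
exact: (rP _ (Dz m)).2.
Qed.

End DivisibleTorsion.

Section DivisibleTorsionFree.
Context {G : groupType} (D : set G) (divD : divisible_subgroup D).
Hypothesis tfD : forall n x, (0 < n)%N -> D x -> x ^+ n = 1 -> x = 1.
Variables (x : G) (Dx : D x) (x1 : x <> 1).

(** Roots are unique in a torsion-free abelian group, so rational powers of x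
    are well defined: [rpow r y] says that y is the r-th power of x, where
    r = (a - b) / d. *)
Let rpow (r : rat) (y : G) : Prop :=
  D y /\ exists a b d : nat,
    [/\ (0 < d)%N, (r * d%:R + b%:R = a%:R)%R & y ^+ d * x ^+ b = x ^+ a].

Let cD y y' : D y -> D y' -> commute y y'.
Proof. by have [_ cD _] := divD; apply: cD. Qed.

Let sD : subgroup D. Proof. by have [] := divD. Qed.

Let x_inj a b : x ^+ a = x ^+ b -> a = b.
Proof.
wlog ab : a b / (a <= b)%N.
  by move=> W; case: (leqP a b) => [|/ltnW] ab E; [exact: W | apply/esym/W].
move=> E; have [ba|ba] := leqP b a; first by apply/eqP; rewrite eqn_leq ab.
case: x1; apply: (@tfD (b - a)) => //; first by rewrite subn_gt0.
by rewrite expgnFr // E divgg.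
Qed.

Let cX y y' m n : D y -> D y' -> commute (y ^+ m) (y' ^+ n).
Proof. by move=> Dy Dy'; apply: commuteX2; apply: cD. Qed.

Let rpow_expg y a b d e : D y -> y ^+ d * x ^+ b = x ^+ a ->
  y ^+ (d * e) * x ^+ (b * e) = x ^+ (a * e).
Proof. by move=> Dy E; rewrite !expgnA -expgMn ?E //; apply: cX. Qed.

Let rpow_uniq r y y' : rpow r y -> rpow r y' -> y = y'.
Proof.
move=> [Dy [a [b [d [d0 rE yE]]]]] [Dy' [a' [b' [d' [d'0 rE' yE']]]]].
have key : (a * d' + b' * d = a' * d + b * d')%N.
  by apply/eqP; rewrite -(eqr_nat rat) !natrD !natrM -rE -rE'; apply/eqP; ring.
have u := rpow_expg d' Dy yE; have u' := rpow_expg d Dy' yE'.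
have uu' : y ^+ (d * d') = y' ^+ (d * d').
  apply: (@mulIg _ (x ^+ (b * d' + b' * d))).
  rewrite {1}expgnDr [LHS]mulgA u -expgnDr key (addnC (b * d')%N).
  by rewrite [in RHS]expgnDr [RHS]mulgA (mulnC d) u' -expgnDr.
apply: divg1_eq; apply: (@tfD (d * d')) => //; first by rewrite muln_gt0 d0.
  by apply: subgroupM => //; apply: subgroupV.
by rewrite expgnFl ?uu' ?divgg //; apply: cD.
Qed.

Let rpow_add r r' y y' : rpow r y -> rpow r' y' -> rpow (r + r')%R (y * y').
Proof.
move=> [Dy [a [b [d [d0 rE yE]]]]] [Dy' [a' [b' [d' [d'0 rE' yE']]]]].
split; first exact: subgroupM.
exists (a * d' + a' * d)%N, (b * d' + b' * d)%N, (d * d')%N; split.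
- by rewrite muln_gt0 d0.
- rewrite !natrD !natrM -rE -rE'; ring.
- rewrite expgMn; last exact: cD.
  rewrite (expgnDr x (b * d')) mulgA -(mulgA (_ ^+ _)) (cX _ _ Dy' Dx) mulgA.
  rewrite (rpow_expg d' Dy yE) -mulgA (mulnC d) (rpow_expg d Dy' yE').
  by rewrite -expgnDr.
Qed.

Let rpow_ex r : exists y, rpow r y.
Proof.
have [a [b ab]] : exists a b : nat, numq r = (a%:Z - b%:Z)%R.
  case: (numq r) => n; first by exists n, 0%N; rewrite subr0.
  by exists 0%N, n.+1; rewrite sub0r NegzE.
have d0 : (0 < `|denq r|)%N by rewrite absz_gt0 denq_neq0.
have [_ _ rootD] := divD.
have [|y Dy yE] := rootD `|denq r|%N (x ^+ a / x ^+ b) d0.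
  by apply: subgroupM => //; [|apply: subgroupV => //]; apply: subgroupX.
exists y; split=> //; exists a, b, `|denq r|%N; split=> //.
  rewrite pmulrn absz_denq -{1}[r]divq_num_den divfK ?intr_eq0 ?denq_neq0 //.
  by rewrite ab rmorphB /= subrK.
by rewrite yE mulgVK.
Qed.

Lemma divisible_torsion_free_rat :
  has_subgroup_isomorphic_to G (Algebra.to_multiplicative rat).
Proof.
have [f fP] := choice rpow_ex.
have fD a b : f (a + b)%R = f a * f b.
  by apply: (@rpow_uniq (a + b)%R) => //; apply: rpow_add.
apply/has_subgroup_isomorphic_toP.
exists (@hom_of (Algebra.to_multiplicative _) _ f fD).
apply: hom_inj => r /= fr1.
have [_ [a [b [d [d0 rE]]]]] := fP r.
rewrite fr1 expg1n mul1g => /x_inj ba.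
apply/eqP; move: rE; rewrite ba -[RHS]add0r => /addIr/eqP.
rewrite mulf_eq0 pnatr_eq0.
by rewrite -[d == 0%N]negbK -lt0n d0 orbF.
Qed.

End DivisibleTorsionFree.

Lemma root_coprime_torsion (A : zmodType) (m q : nat) (x : A) :
  (0 < q)%N -> coprime q m -> (x *+ m = 0)%R -> exists y, (y *+ q)%R = x.
Proof.
move=> q0 qm xm; case: (egcdnP m q0) => a b E _.
exists (x *+ a)%R; rewrite -mulrnA E (eqP qm) addn1 mulrSr mulnC mulrnA xm.
by rewrite mul0rn add0r.
Qed.

Section PruferDivisible.
Variables (p : nat) (p_pr : prime p).

Lemma prufer_in0 n : prufer_in p_pr (0 : Zpow p n)%R = 0%R.
Proof.
have := prufer_inD p_pr (0%R : Zpow p n) 0%R; rewrite addr0 => E.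
by apply: (addrI (prufer_in p_pr (0%R : Zpow p n))); rewrite -E addr0.
Qed.

Lemma prufer_inMn n (x : Zpow p n) k :
  prufer_in p_pr (x *+ k)%R = (prufer_in p_pr x *+ k)%R.
Proof.
elim: k => [|k IH]; first by rewrite !mulr0n prufer_in0.
by rewrite !mulrS prufer_inD IH.
Qed.

Lemma Zpow_exponent n (x : Zpow p n) : (x *+ p ^ n = 0)%R.
Proof.
rewrite -(Zpow_card p_pr n); apply: val_inj => /=.
by rewrite Zp_mulrn /= modnMl.
Qed.

Lemma prufer_torsion (a : prufer p_pr) : exists n, (a *+ (p ^ n) = 0)%R.
Proof.
have [n [x <-]] := prufer_in_cover a; exists n.
by rewrite -prufer_inMn Zpow_exponent prufer_in0.
Qed.

Lemma prufer_divp (a : prufer p_pr) : exists b, (b *+ p)%R = a.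
Proof.
have [n [x <-]] := prufer_in_cover a.
exists (prufer_in p_pr (inZp (x : 'I_ _) : Zpow p n.+1)).
rewrite -prufer_inMn -[RHS](prufer_in_emb p_pr 1).
apply: (congr1 (@prufer_in p p_pr n.+1)).
by apply: val_inj; rewrite Zp_mulrn /= modnMml expn1 mulnC.
Qed.

(** Division by p goes from Z/p^n to Z/p^n.+1, and division by other primes is
    possible since every element has order a power of p. *)
Lemma prufer_div n (a : prufer p_pr) : (0 < n)%N -> exists b, (b *+ n)%R = a.
Proof.
elim/ltn_ind: n a => n IH a n0.
have [n1|n1] := leqP n 1.
  by exists a; rewrite (_ : n = 1%N) ?mulr1n //; apply/eqP; rewrite eqn_leq n1.
have q_pr := pdiv_prime n1; set q := pdiv n in q_pr.
have nE : (n %/ q * q)%N = n by rewrite divnK ?pdiv_dvd.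
have nq0 : (0 < n %/ q)%N by rewrite divn_gt0 ?pdiv_gt0 // dvdn_leq ?pdiv_dvd.
have [b <-] := IH (n %/ q)%N (ltn_Pdiv (prime_gt1 q_pr) n0) a nq0.
have [c <-] : exists c, (c *+ q)%R = b.
  have [qp|qp] := boolP (coprime q p).
    have [m bm] := prufer_torsion b.
    by apply: (root_coprime_torsion _ _ bm); rewrite ?prime_gt0 // coprimeXr.
  have -> : q = p.
    by apply/eqP; move: qp; rewrite prime_coprime // negbK dvdn_prime2.
  exact: prufer_divp.
by exists c; rewrite -mulrnA mulnC nE.
Qed.

End PruferDivisible.

Lemma divisible_range (A : zmodType) (G : groupType)
    (f : {multiplicative Algebra.to_multiplicative A -> G}) :
  (forall n (a : A), (0 < n)%N -> exists b, (b *+ n)%R = a) ->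
  divisible_subgroup (range f).
Proof.
move=> divA; split.
- by apply: image_subgroup; apply/subgroupP.
- by move=> _ _ [a _ <-] [b _ <-]; apply: gmulf_commute; apply: addrC.
- move=> n _ n0 [a _ <-]; have [b <-] := divA n a n0.
  by exists (f b); [exists b | rewrite hom_mulrn].
Qed.

Lemma small_no_divisible (A : zmodType) (G : groupType) (a : A) :
  (forall n (a : A), (0 < n)%N -> exists b, (b *+ n)%R = a) -> a <> 0%R ->
  small [set: G] ->
  ~ has_subgroup_isomorphic_to G (Algebra.to_multiplicative A).
Proof.
move=> divA a0 [sd _ _] /has_subgroup_isomorphic_toP[f inj_f]; apply: a0.
apply: inj_f; rewrite hom_zero.
by apply: (sd _ (divisible_range f divA)) => //; exists a.
Qed.

Lemma rat_div n (a : rat) : (0 < n)%N -> exists b : rat, (b *+ n)%R = a.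
Proof.
move=> n0; exists (a / n%:R)%R.
by rewrite -[LHS]mulr_natr divfK // pnatr_eq0 -lt0n.
Qed.

Lemma class_G_small (G : groupType) : class_G G <-> small [set: G].
Proof.
split=> [[noQ noZp noPr aG]|smG].
  split.
  - move=> D divD _ x Dx; apply: contrapT => x1.
    have [tf|] := pselect (forall n y, (0 < n)%N -> D y -> y ^+ n = 1 -> y = 1).
      by apply: noQ; apply: (divisible_torsion_free_rat divD tf Dx).
    move/existsNP => [n /existsNP[y]].
    move=> /not_implyP[n0 /not_implyP[Dy /not_implyP[yn y1]]].
    have [p [p_pr]] := divisible_torsion_prufer divD n0 Dy y1 yn.
    exact: noPr.
  - move=> p f p_pr _ inj_f; apply: (noZp p p_pr).
    by apply/has_subgroup_isomorphic_toP; exists f.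
  - by move=> T tT _; apply: aG.
split.
- exact: (@small_no_divisible rat _ 1%R rat_div).
- have [_ noZp _] := smG.
  by move=> p p_pr /has_subgroup_isomorphic_toP[f]; apply: noZp.
- move=> p p_pr; have p0 := prime_gt0 p_pr.
  apply: (@small_no_divisible _ _ (prufer_in p_pr (inZp 1 : Zpow p 1))) => //.
    by move=> n a; apply: prufer_div.
  rewrite -(prufer_in0 p_pr 1) => /prufer_in_inj /(congr1 val) /=.
  by rewrite expn1 prednK // modn_small ?prime_gt1.
- by have [_ _ aG] := smG => H tH; apply: aG.
Qed.

(** * Extensions *)

Lemma preimage_subgroup (G C : groupType) (f : {multiplicative G -> C})
    (K : set C) :
  subgroup K -> subgroup (f @^-1` K).
Proof.
move=> /subgroupP[K1 KF]; apply/subgroupP; split; first by rewrite /= hom1.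
by move=> x y Kx Ky; rewrite /= homF; apply: KF.
Qed.

Lemma small_embedding (G C : groupType) (f : {multiplicative G -> C}) :
  injective f -> small [set: G] -> small (range f).
Proof.
move=> inj_f [Gd Gp Ga].
have ffK (K : set C) : K `<=` range f -> f @` (f @^-1` K) = K.
  move=> Kf; apply/seteqP; split=> [_ [x Kx <-] //|y Ky].
  by have [x _ xy] := Kf y Ky; exists x => //; rewrite /= xy.
split.
- move=> D [sD cD dD] Df; have dfD : divisible_subgroup (f @^-1` D).
    split; first exact: preimage_subgroup.
      move=> x y Dx Dy; apply: inj_f.
      by rewrite !gmulfM; apply: cD.
    move=> n x n0 Dx; have [y Dy yx] := dD n (f x) n0 Dx.
    have [z _ zy] := Df y Dy; exists z; first by rewrite /= zy.
    by apply: inj_f; rewrite homX zy.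
  move=> y Dy; have [x _ xy] := Df y Dy.
  have x1 : x = 1 by apply: (Gd _ dfD) => //; rewrite /= xy.
  by rewrite -xy x1 hom1.
- move=> p g p_pr gf inj_g.
  have /choice[h hE] : forall x, exists a, f a = g x.
    by move=> x; have [|y _ yE] := gf (g x); [exists x | exists y].
  have hM : {morph h : x y / x * y}.
    by move=> x y; apply: inj_f; rewrite gmulfM !hE gmulfM.
  apply: (Gp p (hom_of hM)) => // x y hxy.
  by apply: inj_g; rewrite -!hE; congr (f _).
- move=> T [sT torT] Tf; split=> // F [K0 FK0] Fsub.
  have [_ aT] : artinian_subgroup (f @^-1` T).
    apply: Ga => //; split; first exact: preimage_subgroup.
    move=> x Tx; have [n n0 fxn] := torT (f x) Tx; exists n => //.
    by apply: inj_f; rewrite homX fxn hom1.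
  have [_ [K FK <-] Kmin] :
      exists2 M, [set f @^-1` K | K in F] M &
        forall L, [set f @^-1` K | K in F] L -> L `<=` M -> L = M.
    apply: aT; first by exists (f @^-1` K0); exists K0.
    move=> _ [K FK <-]; have [sK KT] := Fsub K FK.
    by split; [apply: preimage_subgroup | move=> x /KT].
  exists K => // L FL LK.
  have Ff M : F M -> M `<=` range f by case/Fsub=> _ MT; apply: subset_trans Tf.
  rewrite -(ffK L (Ff L FL)) -(ffK K (Ff K FK)); congr (f @` _).
  by apply: Kmin; [exists L | move=> x /LK].
Qed.

Lemma class_G_extension (A B C : groupType)
    (f : {multiplicative A -> B}) (g : {multiplicative B -> C}) :
  short_exact f g -> class_G A -> class_G C -> class_G B.
Proof.
move=> [inj_f fg _] /class_G_small smA /class_G_small smC.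
apply/class_G_small/(small_extension (f := g)).
  exact: small_sub smC.
rewrite setTI -[kernel g]/[set b | g b = 1] -fg.
exact: small_embedding.
Qed.

(** * Graph products: universal property, generators, retractions *)

Section FreeProductLift.
Context {V : choiceType} {G : V -> groupType} {P : groupType}.
Context (phi : forall u, G u -> P).
Hypothesis phiM : forall u, {morph @phi u : x y / x * y}.

Let wmap (w : seq (syllable G)) : P := \prod_(s <- w) phi (tagged s).

Let wmap_eq w w' : free_prod_eq w w' -> wmap w = wmap w'.
Proof.
elim=> // [w1 w2 w3 _ -> _ -> //|w1 w2 u g h|w1 w2 u].
  by rewrite /wmap !big_cat !big_cons /= phiM; congr (_ * _); rewrite mulgA.
have phi1 : phi (1 : G u) = 1 by exact: (hom1 (hom_of (@phiM u))).
by rewrite /wmap !big_cat !big_cons /= phi1 mul1g.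
Qed.

Let fp_lift (x : free_product G) : P := wmap (repr x).

Let fp_mapE w : fp_lift (\pi_(free_product G) w) = wmap w.
Proof. exact/esym/wmap_eq/fp_repr. Qed.

Let fp_mapM : {morph fp_lift : x y / x * y}.
Proof.
move=> x y; rewrite -[x]reprK -[y]reprK.
transitivity (fp_lift (\pi_(free_product G) (repr x ++ repr y))).
  by congr fp_lift; apply/esym; apply: fp_piM.
by rewrite !fp_mapE /wmap big_cat.
Qed.

Lemma free_product_lift : exists f : {multiplicative free_product G -> P},
  forall u (g : G u), f (fp_in g) = phi g.
Proof.
exists (hom_of fp_mapM) => u g.
by rewrite -[LHS]/(fp_lift _) fp_mapE /wmap big_cons big_nil mulg1.
Qed.

End FreeProductLift.

Section QuotientLift.
Context {G P : groupType} (S : set G) (f : {multiplicative G -> P}).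
Hypothesis fS : S `<=` kernel f.

Let q_map (x : relators_quotient S) : P := f (repr x).

Let kerf x : normal_closure S x -> f x = 1.
Proof.
apply: (normal_closure_min _ fS); split; first exact: kernel_subgroup.
by move=> y z fy; rewrite /kernel /= /conjg !gmulfM homV fy mul1g mulVg.
Qed.

Let q_mapE x : q_map (quot_proj S x) = f x.
Proof.
have := kerf (quot_repr x); rewrite gmulfM homV => /(congr1 ( *%g (f x))).
by rewrite mulVKg mulg1.
Qed.

Lemma relators_quotient_lift :
  exists h : {multiplicative relators_quotient S -> P},
    forall x, h (quot_proj S x) = f x.
Proof.
have q_mapM : {morph q_map : x y / x * y}.
  move=> x y; have [a <-] := quot_proj_surj x; have [b <-] := quot_proj_surj y.
  by rewrite -gmulfM !q_mapE gmulfM.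
by exists (hom_of q_mapM).
Qed.

End QuotientLift.

Section GraphProduct.
Context {V : choiceType} {E : rel V} {G : V -> groupType}.
Local Notation GG := (graph_product E G).

Definition gp_in u (g : G u) : GG := quot_proj (graph_relators E G) (fp_in g).

Lemma gp_inM u : {morph @gp_in u : g h / g * h}.
Proof. by move=> g h; rewrite /gp_in !gmulfM. Qed.

Lemma gp_in1 u : gp_in (1 : G u) = 1.
Proof. exact: (hom1 (hom_of (@gp_inM u))). Qed.

Lemma gp_inV u (g : G u) : gp_in g^-1 = (gp_in g)^-1.
Proof. exact: (homV (hom_of (@gp_inM u))). Qed.

Lemma gp_in_commute u v (g : G u) (h : G v) :
  E u v -> commute (gp_in g) (gp_in h).
Proof.
move=> uv; apply/commgP/eqP.
have : quot_proj (graph_relators E G) [~ fp_in g, fp_in h] = 1.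
  by apply/quot_projP; apply: sub_normal_closure; exists u, v, g, h.
by rewrite /commg /conjg !gmulfM !homV.
Qed.

Lemma graph_product_lift (P : groupType) (phi : forall u, G u -> P) :
  (forall u, {morph @phi u : x y / x * y}) ->
  (forall u v (g : G u) (h : G v), E u v -> commute (phi u g) (phi v h)) ->
  exists f : {multiplicative GG -> P},
    forall u (g : G u), f (gp_in g) = phi u g.
Proof.
move=> phiM phiC; have [f fE] := free_product_lift phiM.
have [|h hE] := @relators_quotient_lift _ _ (graph_relators E G) f.
  move=> _ [u [v [g [h [uv ->]]]]]; rewrite /kernel /=.
  rewrite /commg /conjg !gmulfM !homV !fE; apply/eqP/commgP; exact: phiC.
by exists h => u g; rewrite hE fE.
Qed.

(** The inverse of a syllable is a syllable, so that every element is a product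
    of elements of the factors, without inverses. *)
Lemma graph_product_ind (Q : GG -> Prop) :
  Q 1 -> (forall u (g : G u) x, Q x -> Q (gp_in g * x)) -> forall x, Q x.
Proof.
move=> Q1 QM x; have [y <-] := quot_proj_surj x; elim/quotW: y => w.
elim: w => [|[u g] w IH].
  have E1 := hom1 (quot_proj (graph_relators E G)).
  by rewrite (_ : quot_proj _ _ = 1).
rewrite (_ : quot_proj _ _ = gp_in g *
  quot_proj (graph_relators E G) (\pi_(free_product G) w)).
  exact: QM.
by rewrite /gp_in -gmulfM; congr quot_proj; apply: (fp_piM [:: syl g] w).
Qed.

Inductive generated (S : seq V) : set GG :=
| generated1 : generated S 1
| generatedM u (g : G u) x :
    u \in S -> generated S x -> generated S (gp_in g * x).

Lemma generated_in S u (g : G u) : u \in S -> generated S (gp_in g).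
Proof.
move=> uS; rewrite -[gp_in g]mulg1.
by apply: generatedM => //; apply: generated1.
Qed.

Lemma generated_mul S x y :
  generated S x -> generated S y -> generated S (x * y).
Proof.
move=> Sx Sy; elim: Sx => [|u g {}x uS _ IH]; first by rewrite mul1g.
by rewrite -mulgA; apply: generatedM.
Qed.

Lemma generated_subgroup S : subgroup (generated S).
Proof.
apply/subgroupP; split=> [|x y Sx Sy]; first exact: generated1.
apply: generated_mul => //; elim: Sy => [|u g {}y uS _ IH].
  by rewrite invg1; apply: generated1.
rewrite invgM; apply: generated_mul => //.
by rewrite -gp_inV; apply: generated_in.
Qed.

Lemma generated_sub S S' : {subset S <= S'} -> generated S `<=` generated S'.
Proof.
move=> SS' x; elim=> [|u g {}x /SS' uS' _ IH]; first exact: generated1.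
exact: generatedM.
Qed.

Lemma generated_retraction S : exists rho : {multiplicative GG -> GG},
  [/\ forall u (g : G u), rho (gp_in g) = if u \in S then gp_in g else 1,
      forall x, generated S (rho x) &
      forall x, generated S x -> rho x = x].
Proof.
have [|u v g h uv|rho rhoE] :=
    @graph_product_lift GG (fun u (g : G u) => if u \in S then gp_in g else 1).
- by move=> u g h; case: ifP; rewrite ?gp_inM ?mulg1.
- case: ifP => _; last exact/commute_sym/commute1.
  by case: ifP => _; [apply: gp_in_commute | apply: commute1].
exists rho; split=> //.
  elim/graph_product_ind => [|u g x IH].
    by rewrite hom1; apply: generated1.
  rewrite gmulfM rhoE; case: ifP => uS; last by rewrite mul1g.
  exact: generatedM.
by move=> x; elim=> [|u g {}x uS _ IH]; rewrite ?hom1 // gmulfM rhoE uS IH.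
Qed.

(** The identity of G v, extended trivially to the other factors: the equality
    test on vertices is needed to transport G u to G v. *)
Definition factor_proj v u (g : G u) : G v :=
  if u =P v is ReflectT uv then ecast w (G w) uv g else 1.

Lemma factor_projE v (g : G v) : factor_proj v g = g.
Proof.
rewrite /factor_proj; case: eqP => // vv.
by rewrite (eq_irrelevance vv erefl).
Qed.

Lemma factor_proj_neq v u (g : G u) : u != v -> factor_proj v g = 1.
Proof. by rewrite /factor_proj; case: eqP. Qed.

Lemma factor_projM v u : {morph @factor_proj v u : g h / g * h}.
Proof.
move=> g h; have [uv|uv] := eqVneq u v; last by rewrite !factor_proj_neq ?mulg1.
by case: _ / uv; rewrite !factor_projE.
Qed.

Lemma vertex_retraction v : irreflexive E ->
  exists r : {multiplicative GG -> G v},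
    forall u (g : G u), r (gp_in g) = factor_proj v g.
Proof.
move=> irrE; apply: graph_product_lift => [u|u w g h uw].
  exact: factor_projM.
have [uv|uv] := eqVneq u v; last first.
  by rewrite (factor_proj_neq _ uv); apply/commute_sym/commute1.
rewrite (factor_proj_neq h); first exact: commute1.
by apply: contraTneq uw => ->; rewrite uv irrE.
Qed.

End GraphProduct.

(** * Unipotent operators on noncommutative power series *)

Section Bijections.
Variable T : Type.

Record bijection := Bijection {
  bij_fun :> T -> T;
  bij_inv : T -> T;
  bij_funK : cancel bij_fun bij_inv;
  bij_invK : cancel bij_inv bij_fun
}.

Lemma bij_ext (a b : bijection) : a =1 b -> a = b.
Proof.
case: a b => [f g fK gK] [f' g' fK' gK'] /= /funext ff'; subst f'.
have gg' : g = g' by apply: funext => x; rewrite -{1}(gK' x) fK.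
by subst g'; congr Bijection; apply: Prop_irrelevance.
Qed.

HB.instance Definition _ := gen_eqMixin bijection.
HB.instance Definition _ := gen_choiceMixin bijection.

Definition bij_one := @Bijection id id (fun _ => erefl) (fun _ => erefl).
Definition bij_opp (a : bijection) := Bijection (bij_invK a) (bij_funK a).
Definition bij_mul (a b : bijection) :=
  @Bijection (a \o b) (bij_inv b \o bij_inv a)
    (can_comp (bij_funK a) (bij_funK b)) (can_comp (bij_invK b) (bij_invK a)).

Lemma bij_mulA : associative bij_mul.
Proof. by move=> a b c; apply: bij_ext. Qed.
Lemma bij_mul1 : left_id bij_one bij_mul.
Proof. by move=> a; apply: bij_ext. Qed.
Lemma bij_1mul : right_id bij_one bij_mul.
Proof. by move=> a; apply: bij_ext. Qed.
Lemma bij_mulV : left_inverse bij_one bij_opp bij_mul.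
Proof. by move=> a; apply: bij_ext => x; apply: bij_funK. Qed.
Lemma bij_Vmul : right_inverse bij_one bij_opp bij_mul.
Proof. by move=> a; apply: bij_ext => x; apply: bij_invK. Qed.

HB.instance Definition _ := isGroup.Build bijection
  bij_mulA bij_mul1 bij_1mul bij_mulV bij_Vmul.

End Bijections.

Section Unipotent.
Variable X : Type.
Local Notation M := (seq X -> int).
Implicit Types (f g : M) (T Y : bijection M) (w : seq X).
Local Open Scope ring_scope.

(** A function on words is read as a power series in noncommuting variables; the
    series vanishing to order d form a filtration. *)
Definition vanishes d f := forall w, (size w < d)%N -> f w = 0.

Lemma vanishesD d f g : vanishes d f -> vanishes d g -> vanishes d (f + g).
Proof. by move=> f0 g0 w wd; rewrite [LHS]/(f w + g w) f0 // g0 // addr0. Qed.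

Lemma vanishes_le d e f : (d <= e)%N -> vanishes e f -> vanishes d f.
Proof. by move=> de f0 w wd; apply: f0; apply: leq_trans de. Qed.

Definition additive_op T := forall f g, T (f + g) = T f + T g.

(** T - 1 raises the filtration degree by k. *)
Definition raises T k :=
  forall d f, vanishes d f -> vanishes (d + k) (T f - f).

Definition unipotent T := additive_op T /\ raises T 1.

Lemma bijX T n f : (T ^+ n.+1)%g f = (T ^+ n)%g (T f).
Proof. by rewrite expgSr. Qed.

Lemma additive_opX T n : additive_op T -> additive_op (T ^+ n)%g.
Proof.
move=> aT; elim: n => [|n IH] f g //.
by rewrite !bijX aT IH.
Qed.

Lemma raises_le T k l : (k <= l)%N -> raises T l -> raises T k.
Proof.
by move=> kl rT d f f0; apply: vanishes_le (rT d f f0); rewrite leq_add2l.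
Qed.

Lemma raisesX T k n : raises T k -> raises (T ^+ n)%g k.
Proof.
move=> rT; elim: n => [|n IH] d f f0.
  by move=> w _; apply: subrr.
rewrite bijX (_ : _ - f = ((T ^+ n)%g (T f) - T f) + (T f - f)); last first.
  by rewrite addrA subrK.
apply: vanishesD; last exact: rT.
apply: IH; rewrite -[T f](subrK f); apply: vanishesD => //.
by apply: vanishes_le (rT d f f0); rewrite leq_addr.
Qed.

(** With T = 1 + A this is (1 + A)^n = 1 + n A + terms of higher order. *)
Lemma power_leading T k n d f :
  additive_op T -> raises T k.+1 -> vanishes d f ->
  vanishes (d + k.+2) ((T ^+ n)%g f - f - (T f - f) *+ n).
Proof.
move=> aT rT f0; elim: n => [|n IH].
  by rewrite mulr0n subr0 => w _; apply: subrr.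
set g := T f - f; have -> : (T ^+ n.+1)%g f - f - g *+ n.+1 =
    ((T ^+ n)%g f - f - g *+ n) + ((T ^+ n)%g g - g).
  rewrite bijX -{1}[T f](subrK f) -/g additive_opX // mulrSr.
  have regroup (A : zmodType) (a b c a' b' : A) :
      b + a - c - (a' + b') = (a - c - a') + (b - b').
    rewrite opprD (addrC b) -!addrA; congr (a + _).
    by rewrite (addrCA b) (addrCA b).
  exact: regroup.
apply: vanishesD => //.
apply: vanishes_le (raisesX n rT (rT d f f0)).
by rewrite -addnA leq_add2l addSnnS leq_addl.
Qed.

(** By [power_leading] the leading term of Y^n - 1 is n times that of Y - 1, and
    the integers have no torsion. *)
Lemma raises_root Y k n : unipotent Y -> (0 < n)%N ->
  raises (Y ^+ n)%g k.+1 -> raises Y k.+1.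
Proof.
move=> [aY r1] n0; elim: k => [//|k IH] rYn.
have rY : raises Y k.+1 by apply: IH; apply: raises_le rYn.
move=> d f f0 w wd; have := power_leading n aY rY f0 wd.
have H := rYn d f f0 w wd.
have fnE (h : M) m : (h *+ m) w = h w *+ m.
  by elim: m => // m IHm; rewrite !mulrS -IHm.
rewrite -[LHS]/((((Y ^+ n)%g f - f) w) - ((Y f - f) *+ n) w).
rewrite H sub0r fnE => /eqP.
by rewrite oppr_eq0 mulrn_eq0 eqn0Ngt n0 => /eqP.
Qed.

(** If T - 1 raises the degree by more than the length of w, then f and T f have
    the same coefficient at w. *)
Lemma raises_all_eq1 T : (forall k, raises T k.+1) -> T = 1%g.
Proof.
move=> rT; apply: bij_ext => f; apply: funext => w; apply/eqP.
have /eqP := rT (size w) 0%N f (fun _ => ltac:(by [])) w (leqnn _).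
by rewrite -[X in X == _]/(T f w - f w) subr_eq0.
Qed.

Lemma unipotent_torsion_free T n :
  unipotent T -> (0 < n)%N -> (T ^+ n = 1)%g -> T = 1%g.
Proof.
move=> uT n0 Tn; apply: raises_all_eq1 => k; apply: (raises_root uT n0).
by rewrite Tn => d f _ w _; apply: subrr.
Qed.

(** If T - 1 raises the degree by k, the coefficients of its part of degree
    exactly k are divisible by q^j for all j, as T is a q^j-th power: they
    vanish, so T - 1 raises the degree by k + 1. *)
Lemma unipotent_no_roots T q : prime q ->
  (forall j, exists2 Y, unipotent Y & (Y ^+ (q ^ j) = T)%g) -> T = 1%g.
Proof.
move=> q_pr roots; apply: raises_all_eq1; elim=> [|k IH].
  by have [Y [_ rY] <-] := roots 0%N; rewrite expn0 expg1.
move=> d f f0 w wd.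
have dvd j : exists e : int, (T f - f) w = e *+ (q ^ j).
  have [Y uY YT] := roots j.
  have q0 : (0 < q ^ j)%N by rewrite expn_gt0 prime_gt0.
  have rY : raises Y k.+1 by apply: (raises_root uY q0); rewrite YT.
  exists ((Y f - f) w); have [aY _] := uY.
  have := power_leading (q ^ j) aY rY f0 wd.
  have fnE (h : M) m : (h *+ m) w = h w *+ m.
    by elim: m => // m IHm; rewrite !mulrS -IHm.
  rewrite YT -[LHS]/((T f - f) w - ((Y f - f) *+ _) w) fnE => /eqP.
  by rewrite subr_eq0 => /eqP.
move: {dvd}(_ w) dvd => c dvd.
apply/eqP; rewrite -absz_eq0; apply/negPn/negP; rewrite -lt0n => c0.
have [e cE] := dvd (absz c).
have := ltn_expl (absz c) (prime_gt1 q_pr).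
rewrite ltnNge => /negP; apply.
rewrite {2}cE -mulr_natr abszM natz absz_nat leq_pmull // lt0n absz_eq0.
by apply: contraTneq c0 => e0; rewrite cE e0 mul0rn.
Qed.

End Unipotent.

(** * Translations and Magnus operators *)

Section Operators.
Variable Q : groupType.
Local Notation M := (seq Q -> int).
Implicit Types (f : M) (T : bijection M) (w : seq Q) (q s t : Q) (A B : set Q).

Let shift_fun q f : M := fun w => f [seq q^-1 * s | s <- w].
Let shift_funK q : cancel (shift_fun q) (shift_fun q^-1).
Proof.
move=> f; apply: funext => w; rewrite /shift_fun -map_comp; congr f.
by rewrite -[RHS]map_id; apply: eq_map => s /=; rewrite invgK mulKg.
Qed.
Let shift_funKV q : cancel (shift_fun q^-1) (shift_fun q).
Proof. by move=> f; rewrite -{1}[q]invgK shift_funK. Qed.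

Definition shift q : bijection M := Bijection (shift_funK q) (shift_funKV q).

Lemma shiftE q f w : shift q f w = f [seq q^-1 * s | s <- w].
Proof. by []. Qed.

Lemma shiftM : {morph shift : q q' / q * q'}.
Proof.
move=> q q'; apply: bij_ext => f; apply: funext => w.
rewrite -[RHS]/(f [seq q'^-1 * s | s <- [seq q^-1 * s | s <- w]]) shiftE.
congr f; rewrite -map_comp; apply: eq_map => s /=.
by rewrite invgM mulgA.
Qed.

Definition masked A s (n : int) : int := if `[< A s >] then n else 0%R.

(** Left multiplication by 1 + a, where a is the possibly infinite sum of the
    letters in A. *)
Let magnus_fun A f : M :=
  fun w => if w is s :: w' then (f w + masked A s (f w'))%R else f [::].
Let magnus_inv_fun A f : M :=
  fix g w := if w is s :: w' then (f w - masked A s (g w'))%R else f [::].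
Let magnus_funK A : cancel (magnus_fun A) (magnus_inv_fun A).
Proof.
move=> f; apply: funext; elim=> //= s w ->.
by rewrite addrK.
Qed.
Let magnus_inv_funK A : cancel (magnus_inv_fun A) (magnus_fun A).
Proof.
by move=> f; apply: funext; case=> //= s w; rewrite subrK.
Qed.

Definition magnus A : bijection M :=
  Bijection (@magnus_funK A) (@magnus_inv_funK A).

Lemma magnus_cons A f s w :
  magnus A f (s :: w) = (f (s :: w) + masked A s (f w))%R.
Proof. by []. Qed.
Lemma magnusV_nil A f : (magnus A)^-1%g f [::] = f [::]. Proof. by []. Qed.
Lemma magnusV_cons A f s w :
  (magnus A)^-1%g f (s :: w) =
  (f (s :: w) - masked A s ((magnus A)^-1%g f w))%R.
Proof. by []. Qed.

Lemma magnus_shift_commute A q :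
  (forall s, A (q * s) <-> A s) -> commute (magnus A) (shift q).
Proof.
move=> qA; apply: bij_ext => f; apply: funext => -[|s w] //.
change (magnus A (shift q f) (s :: w) =
        magnus A f (q^-1 * s :: [seq q^-1 * s | s <- w])).
rewrite !magnus_cons; congr (_ + _)%R; rewrite /masked.
congr (if _ then _ else _); apply/asboolP/asboolP;
  by rewrite -(qA (q^-1 * s)) mulVKg.
Qed.

(** T is the translation by q up to terms of higher degree. *)
Definition has_symbol T q := additive_op T /\
  forall d f, vanishes d f -> vanishes d.+1 (T f - shift q f)%R.

Lemma vanishes_shift d f q : vanishes d f -> vanishes d (shift q f).
Proof. by move=> f0 w wd; rewrite shiftE f0 // size_map. Qed.

(** T T' - q q' = T (T' - q') + (T - q) q', where T preserves the filtration
    because the translation by q does. *)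
Lemma has_symbolM T T' q q' :
  has_symbol T q -> has_symbol T' q' -> has_symbol (T * T') (q * q').
Proof.
move=> [aT sT] [aT' sT']; split=> [f g|d f f0].
  by rewrite -[LHS]/(T (T' (f + g))%R) aT' aT.
rewrite shiftM -[X in vanishes _ X]/(T (T' f) - shift q (shift q' f))%R.
set g := shift q' f; have g0 : vanishes d g by apply: vanishes_shift.
rewrite -[T' f](subrK g) aT -addrA.
apply: vanishesD; last exact: sT.
set h := (T' f - g)%R; have h0 : vanishes d.+1 h by apply: sT'.
rewrite -[T h](subrK (shift q h)); apply: vanishesD; last exact: vanishes_shift.
by apply: vanishes_le (sT _ _ h0); rewrite leqnSn.
Qed.

Lemma has_symbol_shift q : has_symbol (shift q) q.
Proof. by split=> // d f _ w _; apply: subrr. Qed.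

Lemma maskedD A s m n :
  masked A s (m + n)%R = (masked A s m + masked A s n)%R.
Proof. by rewrite /masked; case: ifP => // _; rewrite addr0. Qed.

Lemma masked0 A s : masked A s 0 = 0%R.
Proof. by rewrite /masked if_same. Qed.

Lemma shift1 f : shift 1 f = f.
Proof.
apply: funext => w; rewrite shiftE; congr f.
by rewrite -[RHS]map_id; apply: eq_map => s; rewrite invg1 mul1g.
Qed.

Lemma shift_one : shift 1 = 1.
Proof. by apply: bij_ext => f; rewrite shift1. Qed.

Lemma has_symbol_magnus A : has_symbol (magnus A) 1.
Proof.
split=> [f g|d f f0].
  apply: funext => -[|s w] //.
  by rewrite magnus_cons -[RHS]/(_ + _)%R !magnus_cons maskedD addrACA.
rewrite shift1 => -[|s w] wd; first exact: subrr.
rewrite -[LHS]/(magnus A f (s :: w) - f (s :: w))%R magnus_cons addrC addKr.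
by rewrite f0 ?masked0.
Qed.

Lemma has_symbol_magnusV A : has_symbol (magnus A)^-1 1.
Proof.
have [aA sA] := has_symbol_magnus A; split=> [f g|d f f0].
  apply: (can_inj (bij_funK (magnus A))).
  rewrite aA -![magnus A ((magnus A)^-1 _)]/((magnus A * (magnus A)^-1)%g _).
  by rewrite mulgV.
rewrite shift1; have g0 : vanishes d ((magnus A)^-1%g f).
  elim=> [|s w IH] wd; first by rewrite magnusV_nil f0.
  by rewrite magnusV_cons f0 // sub0r IH ?(ltnW wd) // masked0 oppr0.
move=> -[|s w] wd; first exact: subrr.
rewrite -[LHS]/((magnus A)^-1%g f (s :: w) - f (s :: w))%R magnusV_cons.
rewrite addrC addKr.
by rewrite g0 // masked0 oppr0.
Qed.

Lemma has_symbol1_unipotent T : has_symbol T 1 -> unipotent T.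
Proof.
by move=> [aT sT]; split=> // d f /sT; rewrite shift1 addn1.
Qed.

(** An invariant that follows one nonzero coefficient, at the word w, through a
    product of translations and Magnus operators.  The set B contains the first
    letter of w.  The coefficients are required to vanish at the words that
    continue w to the left by a letter outside B: this is what keeps the
    coefficient at w from being cancelled, and the invariant alive, when the
    next operator involves only letters outside B. *)
Definition leading f w B :=
  [/\ f w <> 0%R, forall u t, ~ B t -> f (u ++ t :: w) = 0%R &
      forall s w', w = s :: w' -> B s].

Definition delta_nil : M := fun w => if w is [::] then 1%R else 0%R.

Lemma leading_delta : leading delta_nil [::] set0.
Proof. by split=> // -[|? ?]. Qed.

Lemma leading_shift f w B q : leading f w B ->
  leading (shift q f) [seq q * s | s <- w] [set s | B (q^-1 * s)].
Proof.
have qK (v : seq Q) : [seq q^-1 * s | s <- [seq q * s | s <- v]] = v.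
  by rewrite -map_comp -[RHS]map_id; apply: eq_map => s /=; rewrite mulKg.
move=> [fw ftail wB]; split.
- by rewrite shiftE qK.
- by move=> u t Bt; rewrite shiftE map_cat /= qK; apply: ftail.
- by case: w wB {fw ftail} => // s w wB _ _ [<- _] /=; rewrite mulKg; apply: wB.
Qed.

Lemma leading_magnus f w A B s : leading f w B -> A s ->
  (forall t, A t -> ~ B t) -> leading (magnus A f) (s :: w) A.
Proof.
move=> [fw ftail wB] As AB; have Bs := AB s As.
have fs u : f (u ++ s :: w) = 0%R by apply: ftail.
split.
- rewrite magnus_cons [f _](fs [::]) add0r /masked.
  by have -> : `[< A s >] by apply/asboolP.
- move=> [|a u] t At; rewrite ?cat_cons ?cat0s magnus_cons.
    rewrite [f _](fs [:: t]) add0r /masked.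
    by have -> : `[< A t >] = false by apply/asboolPn.
  have f0 v : f (v ++ t :: s :: w) = 0%R by rewrite -cat_rcons fs.
  by rewrite -cat_cons !f0 masked0 addr0.
- by move=> _ _ [<- _].
Qed.

(** The inverse of 1 + a is the infinite series 1 - a + a^2 - ..., but the words
    starting with two letters of A lie outside the range of the invariant. *)
Lemma leading_magnusV f w A B s : leading f w B -> A s ->
  (forall t, A t -> ~ B t) -> leading ((magnus A)^-1%g f) (s :: w) A.
Proof.
move=> [fw ftail wB] As AB; have Bs := AB s As.
have fs u : f (u ++ s :: w) = 0%R by apply: ftail.
have gw : (magnus A)^-1%g f w = f w.
  case: w fw wB {ftail fs} => // b w _ wB; rewrite magnusV_cons /masked.
  have -> : `[< A b >] = false.
    by apply/asboolPn => /AB; apply; apply: wB.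
  by rewrite subr0.
split.
- rewrite magnusV_cons [f _](fs [::]) sub0r gw /masked.
  have -> : `[< A s >] by apply/asboolP.
  by move/eqP; rewrite oppr_eq0 => /eqP.
- move=> u t At.
  have f0 v : f (v ++ t :: s :: w) = 0%R by rewrite -cat_rcons fs.
  elim: u => [|a u IH]; rewrite ?cat_cons ?cat0s magnusV_cons.
    rewrite [f _](f0 [::]) sub0r /masked.
    by have -> : `[< A t >] = false by apply/asboolPn.
  by rewrite -cat_cons f0 IH masked0 subr0.
- by move=> _ _ [<- _].
Qed.

End Operators.

(** * Adding a vertex *)

Section VertexExtension.
Context {V : choiceType} {E : rel V} {G : V -> groupType}.
Hypotheses (symE : symmetric E) (irrE : irreflexive E).
Local Notation GG := (graph_product E G).
Variables (S : seq V) (v : V) (vS : v \notin S).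

Local Notation Q := (GG * G v)%type.
Let link := [seq u <- S | E v u].
Let L : set GG := generated link.

(** Translations by (h, 1) with h in L preserve A, while translations by (h, 1)
    with h outside L and by (1, g) with g <> 1 move A off itself. *)
Let A : set Q := [set q | L q.1 /\ q.2 = 1].

Let pairM (h h' : GG) (g g' : G v) : (h, g) * (h', g') = (h * h', g * g') :> Q.
Proof. by []. Qed.

Let inS u (g : G u) : GG := if u \in S then gp_in g else 1.

Let inSM u : {morph @inS u : g h / g * h}.
Proof. by move=> g h; rewrite /inS; case: ifP; rewrite ?gp_inM ?mulg1. Qed.

Let inS_v (g : G v) : inS g = 1.
Proof. by rewrite /inS (negPf vS). Qed.

(** The values of the representation on the factors.  As v is not in S, at most
    one of the two translations is nontrivial. *)
Let vphi u (g : G u) : bijection (seq Q -> int) :=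
  shift (1, factor_proj v g) ^ (magnus A)^-1 * shift (inS g, 1).

Let shift11 : shift ((1, 1) : Q) = 1.
Proof. exact: shift_one. Qed.

Let vphi_v (g : G v) : vphi g = shift (1, g) ^ (magnus A)^-1.
Proof. by rewrite /vphi factor_projE inS_v shift11 mulg1. Qed.

Let vphi_neq u (g : G u) : u != v -> vphi g = shift (inS g, 1).
Proof. by move=> uv; rewrite /vphi factor_proj_neq // shift11 conj1g mul1g. Qed.

Let vphiM u : {morph @vphi u : g h / g * h}.
Proof.
move=> g h; have [uv|uv] := eqVneq u v; last first.
  by rewrite !vphi_neq // -shiftM pairM inSM mulg1.
move: g h; case: _ / (esym uv) => g h; rewrite !vphi_v -conjMg -shiftM pairM.
by rewrite mulg1.
Qed.

Let A_inv (h : GG) s : L h -> A ((h, 1) * s) <-> A s.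
Proof.
move=> Lh; case: s => x y; rewrite pairM mul1g /A /=.
have sL : subgroup L by apply: generated_subgroup.
split=> -[Lx ->]; split=> //; last exact: subgroupM.
by rewrite -(mulKg h x); apply: subgroupM => //; apply: subgroupV.
Qed.

Let inS_commute u w (g : G u) (h : G w) : E u w -> commute (inS g) (inS h).
Proof.
move=> uw; rewrite /inS; case: ifP => _; last exact/commute_sym/commute1.
by case: ifP => _; [apply: gp_in_commute | apply: commute1].
Qed.

Let vphi_v_commute w (g : G v) (h : G w) : E v w -> commute (vphi g) (vphi h).
Proof.
move=> vw; have wv : w != v by apply: contraTneq vw => ->; rewrite irrE.
rewrite vphi_v vphi_neq //; apply: commute_sym.
have cE : commute (shift (inS h, 1 : G v)) (magnus A).
  apply/commute_sym/magnus_shift_commute => s; apply: A_inv.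
  rewrite /inS; case: ifP => wS; last exact: generated1.
  by apply: generated_in; rewrite mem_filter vw.
have cs : commute (shift (inS h, 1 : G v)) (shift (1, g)).
  by rewrite /commute -!shiftM !pairM !mulg1 !mul1g.
rewrite /conjg invgK; apply: commuteM => //; apply: commuteM => //.
exact: commuteV.
Qed.

Let vphiC u w (g : G u) (h : G w) : E u w -> commute (vphi g) (vphi h).
Proof.
have [uv|uv] := eqVneq u v.
  by move: g; case: _ / (esym uv) => g; apply: vphi_v_commute.
have [wv|wv] := eqVneq w v.
  move: h; case: _ / (esym wv) => h; rewrite symE => vu.
  by apply: commute_sym; apply: vphi_v_commute.
move=> uw; rewrite !vphi_neq // /commute -!shiftM !pairM mulg1.
by rewrite (inS_commute g h uw).
Qed.

(** The products g_1 h_1 ... g_n h_n with n > 0, g_i <> 1 in G v and h_i in the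
    subgroup generated by S, the h_i with i < n being outside L. *)
Inductive alternating : GG -> Prop :=
| Alt1 (g : G v) h : g <> 1 -> generated S h -> alternating (gp_in g * h)
| AltS (g : G v) h y : g <> 1 -> generated S h -> ~ L h -> alternating y ->
    alternating (gp_in g * (h * y)).

Let L_commute h (g : G v) : L h -> commute (gp_in g : GG) h.
Proof.
elim=> [|u k x]; first exact: commute1.
rewrite mem_filter => /andP[vu _] _ IH; apply: commuteM => //.
exact: gp_in_commute.
Qed.

Let alternating_mul (g : G v) y : alternating y ->
  generated S (gp_in g * y) \/
  exists2 h, generated S h &
    exists2 y', alternating y' & gp_in g * y = h * y'.
Proof.
have S1 : generated S (1 : GG) by apply: generated1.
case=> [g' h g'1 Sh|g' h y' g'1 Sh Lh Ay']; rewrite mulgA -gp_inM.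
  have [->|gg'] := pselect (g * g' = 1); first by left; rewrite gp_in1 mul1g.
  right; exists 1 => //; exists (gp_in (g * g') * h); first exact: Alt1.
  by rewrite mul1g.
have [->|gg'] := pselect (g * g' = 1).
  by right; exists h => //; exists y' => //; rewrite gp_in1 mul1g.
right; exists 1 => //; exists (gp_in (g * g') * (h * y')); first exact: AltS.
by rewrite mul1g.
Qed.

(** If h_i is in L, it commutes with g_(i+1), and the two elements g_i and
    g_(i+1) of G v can be merged. *)
Lemma generated_normal_form x : generated (v :: S) x ->
  generated S x \/
  exists2 h, generated S h & exists2 y, alternating y & x = h * y.
Proof.
have S1 : generated S (1 : GG) by apply: generated1.
elim=> [|u g {}x]; first by left.
rewrite inE => uvS _ IH; have [uv|uv] := eqVneq u v; last first.
  rewrite (negPf uv) /= in uvS.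
  case: IH => [Sx|[h Sh [y Ay ->]]]; first by left; apply: generatedM.
  right; exists (gp_in g * h); first exact: generatedM.
  by exists y => //; rewrite mulgA.
move: g; case: _ / (esym uv) => g {u uv uvS}.
have [->|g1] := pselect (g = 1); first by rewrite gp_in1 mul1g.
case: IH => [Sx|[h Sh [y Ay ->]]].
  right; exists 1 => //; exists (gp_in g * x); first exact: Alt1.
  by rewrite mul1g.
have [Lh|Lh] := pselect (L h); last first.
  right; exists 1 => //; exists (gp_in g * (h * y)); first exact: AltS.
  by rewrite mul1g.
rewrite mulgA (L_commute g Lh) -mulgA.
case: (alternating_mul g Ay) => [Sgy|[k Sk [y' Ay' ->]]].
  by left; apply: generated_mul.
by right; exists (h * k); [apply: generated_mul | exists y'; rewrite ?mulgA].
Qed.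

Section Representation.
Variable Psi : {multiplicative GG -> bijection (seq Q -> int)}.
Hypothesis PsiE : forall u (g : G u), Psi (gp_in g) = vphi g.
Variables (rho : {multiplicative GG -> GG}) (r : {multiplicative GG -> G v}).
Hypothesis rhoE : forall u (g : G u), rho (gp_in g) = inS g.
Hypothesis rE : forall u (g : G u), r (gp_in g) = factor_proj v g.

(** On the common kernel of the two retractions the symbol is 1: the operators
    are unipotent there. *)
Lemma Psi_symbol x : has_symbol (Psi x) (rho x, r x).
Proof.
elim/(@graph_product_ind V E G): x => [|u g x IH].
  by rewrite !hom1 -shift11; apply: has_symbol_shift.
rewrite !gmulfM PsiE rhoE rE -pairM; apply: has_symbolM => //.
have -> : (inS g, factor_proj v g) = (1, factor_proj v g) * (inS g, 1).
  by rewrite pairM mul1g mulg1.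
apply: has_symbolM; last exact: has_symbol_shift.
rewrite /conjg invgK -[X in has_symbol _ X]mul1g; apply: has_symbolM.
  exact: has_symbol_magnus.
rewrite -[X in has_symbol _ X]mulg1; apply: has_symbolM.
  exact: has_symbol_shift.
exact: has_symbol_magnusV.
Qed.

Lemma Psi_S h : generated S h -> Psi h = shift (h, 1).
Proof.
elim=> [|u g x uS _ IH]; first by rewrite hom1 shift11.
rewrite gmulfM PsiE IH vphi_neq; last by apply: contraNneq vS => <-.
by rewrite -shiftM pairM mulg1 /inS uS.
Qed.

Let A1 : A 1.
Proof. by split=> //; apply: generated1. Qed.

(** Each of the two Magnus operators in e (1, g) e^-1 adds a letter of A to the
    word; the translation in between moves the first one off A. *)
Lemma leading_Psi_gp_in (g : G v) f w B : g <> 1 ->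
  leading f w B -> (forall t, A t -> ~ B t) ->
  exists s w', leading (Psi (gp_in g) f) (s :: w') A.
Proof.
move=> g1 fwB AB; rewrite PsiE vphi_v /conjg invgK.
have lV := leading_magnusV fwB A1 AB; have ls := leading_shift (1, g) lV.
have Ag t : A t -> ~ A ((1, g)^-1 * t).
  case: t => x y [/= _ ->] [_ /= /eqP].
  by rewrite mulg1 invg_eq1 => /eqP; apply: g1.
by have lE := leading_magnus ls A1 Ag; do 2!eexists; exact: lE.
Qed.

Lemma alternating_leading y : alternating y ->
  exists s w, leading (Psi y (@delta_nil Q)) (s :: w) A.
Proof.
have PsiD x x' f : Psi (x * x') f = Psi x (Psi x' f) by rewrite gmulfM.
elim=> [g h g1 Sh|g h y' g1 Sh Lh _ [s [w lw]]].
  rewrite PsiD (Psi_S Sh) (_ : shift _ _ = @delta_nil Q); last first.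
    by apply: funext => -[].
  by apply: leading_Psi_gp_in g1 (@leading_delta Q) _ => t _ [].
rewrite !PsiD (Psi_S Sh).
apply: leading_Psi_gp_in g1 (leading_shift (h, 1) lw) _.
move=> [x z] [/= Lx _] [/= Lhx _]; apply: Lh.
have sL : subgroup L by apply: generated_subgroup.
rewrite -[h]invgK; apply: subgroupV => //.
by rewrite -(mulgK x h^-1); apply: subgroupM => //; apply: subgroupV.
Qed.

Lemma Psi_kernel x : generated (v :: S) x -> Psi x = 1 -> generated S x.
Proof.
move=> /generated_normal_form[//|[h Sh [y Ay ->]]] Psi1.
have [s [w lw]] := alternating_leading Ay.
have [c0 _ _] := leading_shift (h, 1) lw; case: c0.
by rewrite -(Psi_S Sh) -[Psi h _]/((Psi h * Psi y) _) -gmulfM Psi1.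
Qed.

End Representation.

Lemma small_add_vertex :
  small (generated S : set GG) -> small [set: G v] ->
  small (generated (v :: S) : set GG).
Proof.
move=> smS smv.
have [rho [rhoE rho_S rho_id]] := @generated_retraction V E G S.
have [r rE] := @vertex_retraction V E G v irrE.
have [Psi PsiE] := graph_product_lift vphiM vphiC.
apply: (small_extension (f := rho)).
  by apply: small_sub smS => _ [x _ <-]; apply: rho_S.
apply: (small_extension (f := r)); first exact: small_sub smv.
set N := _ `&` kernel r.
have N_unip x : N x -> unipotent (Psi x).
  move=> [[_ /= rhox] rx]; apply: has_symbol1_unipotent.
  by have := Psi_symbol PsiE rhoE rE x; rewrite rhox rx.
have N_inj x : N x -> Psi x = 1 -> x = 1.
  move=> [[Sx rhox] _] Psi1; rewrite -(rho_id x) //.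
  exact: (Psi_kernel PsiE).
apply: root_free_small => [n x Nx n0 xn|q x q_pr Nx roots]; apply: N_inj => //.
  by apply: (unipotent_torsion_free (N_unip x Nx) n0); rewrite -homX xn hom1.
apply: (unipotent_no_roots q_pr) => j; have [y Ny yx] := roots j.
by exists (Psi y); [apply: N_unip | rewrite -homX yx].
Qed.

End VertexExtension.

Lemma small_generated (V : choiceType) (E : rel V) (G : V -> groupType)
    (S : seq V) :
  symmetric E -> irreflexive E -> (forall u, small [set: G u]) ->
  small (generated S : set (graph_product E G)).
Proof.
move=> symE irrE smG; elim: S => [|v S IH].
  have gen1 x : generated [::] x -> x = 1 :> graph_product E G by case.
  by apply: root_free_small => [n x /gen1|q x _ /gen1].
have [vS|vS] := boolP (v \in S); last exact: small_add_vertex.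
by apply: small_sub IH; apply: generated_sub => u; rewrite inE => /predU1P[->|].
Qed.

Lemma class_G_graph_product (V : finType) (E : rel V) (G : V -> groupType) :
  symmetric E -> irreflexive E -> (forall u, class_G (G u)) ->
  class_G (graph_product E G).
Proof.
move=> symE irrE clG; apply/class_G_small.
have := small_generated (enum V) symE irrE
  (fun u => (class_G_small _).1 (clG u)).
apply: small_sub => x _; elim/(@graph_product_ind V E G): x => [|u g x IH].
  exact: generated1.
by apply: generatedM => //; rewrite mem_enum.
Qed.

Theorem propositionD :
  (forall (A B C : groupType)
          (f : {multiplicative A -> B}) (g : {multiplicative B -> C}),
      short_exact f g -> class_G A -> class_G C -> class_G B)
  /\
  (forall (V : finType) (E : rel V) (G : V -> groupType),
      symmetric E -> irreflexive E ->
      (forall u : V, class_G (G u)) ->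
      class_G (graph_product E G)).
Proof.
split; [exact: class_G_extension | exact: class_G_graph_product].
Qed.
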